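(* Fix $\sigma\in\mathcal{S}_n$. Let $l\ge 1$ be a constant, $p\in(0,1]$ and $\delta\in[0,1]$, and let $M$ be the $p$-mix on $M^*$ and the blind choice $\tilde M$, with $q_{k,n}=\Pr[CM(\sigma,\tau)=\sigma_k]$. If $n\ge 7$ and \[\varepsilon\ \ge\ \begin{cases}\ln\left(\dfrac{q_{1,n}-\delta}{q_{l+1,n}}\right) & \text{for } \delta<q_{1,n}-q_{l+1,n},\\[2mm] 0 & \text{for } \delta\ge q_{1,n}-q_{l+1,n},\end{cases}\] then $M$ is $(\varepsilon,\delta)$-differentially private with respect to $d_l$. The bounds are tight. Moreover, $\ln\left(\frac{q_{1,n}-\delta}{q_{l+1,n}}\right)\sim\ln\left(\frac{p-\delta e}{a_{l+1}\, p}\right)$ as $n\to\infty$, where $a_{m}=\sum_{s=m}^{\infty}\frac{1}{s}\left(1-\frac1e\right)^s$.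
   Context: Candidates $\mathcal{C}=\{C_1,\dots,C_n\}$; a qualification ordering $\sigma=(\sigma_1,\dots,\sigma_n)\in\mathcal{S}_n$ is a permutation of $\mathcal{C}$ meaning $\sigma_1>\dots>\sigma_n$; a time ordering $\tau=(\tau_1,\dots,\tau_n)\in\mathcal{T}_n$ is a permutation giving the arrival order, chosen uniformly at random. A stopping time $M:\mathcal{S}_n\times\mathcal{T}_n\to\{1,\dots,n\}$ decides whether to stop at time $t$ based only on the relative order of $\tau_1,\dots,\tau_t$ under $\sigma$ (randomized algorithms may use independent internal randomness); $CM(\sigma,\tau):=\tau_{M(\sigma,\tau)}$. The threshold $t_n$ is the smallest integer $t$ with $\frac1t+\frac1{t+1}+\dots+\frac1{n-1}\le 1$. The secretary algorithm $M^*$ stops at the first $k\ge t_n$ such that $\tau_k$ is the best (under $\sigma$) among $\tau_1,\dots,\tau_k$, and at $n$ if no such $k$ exists. The blind choice $\tilde M$ always stops at time $1$. For $p\in[0,1]$, the $p$-mix on $M^*$ and $\tilde M$ tosses an independent coin with heads probability $p$ and plays $M^*$ on heads, $\tilde M$ on tails. $d_l(\sigma,\rho)$ is the minimum $k$ with $\sigma=\pi_1\circ\cdots\circ\pi_k\circ\rho$, each $\pi_i$ a transposition of two elements at most $l$ positions apart in $\pi_{i+1}\circ\cdots\circ\pi_k\circ\rho$. $M$ is $(\varepsilon,\delta)$-differentially private w.r.t. $d_l$ if for all $S\subseteq\mathcal{C}$ and all $\sigma,\rho$ with $d_l(\sigma,\rho)\le 1$: $\Pr[CM(\sigma,\tau)\in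 S]\le e^{\varepsilon}\Pr[CM(\rho,\tau)\in S]+\delta$. $f(n)\sim g(n)$ means $f(n)/g(n)\to1$. *)

(* Defs.v *)
From HB Require Import structures.
From mathcomp Require Import all_boot all_order all_algebra all_fingroup.
From mathcomp Require Import all_classical all_reals all_analysis.
From mathcomp Require Import zify.

Set Implicit Arguments.
Unset Strict Implicit.
Unset Printing Implicit Defensive.

Import Order.TTheory GRing.Theory Num.Theory.
Import numFieldNormedType.Exports.

Local Open Scope ring_scope.
Local Open Scope classical_set_scope.

(* MathComp and MathComp-Analysis.  There are n.+1 candidates, so that there is always at
   least one.  Candidates, ranks and times are all elements of 'I_n.+1, where
   the ordinal i stands for the (i+1)-st candidate, rank or time.  An ordering
   is a permutation s : 'S_n.+1 seen as the list s 0, s 1, ..., s n of the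
   candidates: a qualification ordering lists them from best to worst and a
   time ordering in order of arrival. *)

Section Algorithms.

Definition better n (sigma : 'S_n.+1) (c d : 'I_n.+1) : bool :=
  ((sigma^-1)%g c < (sigma^-1)%g d)%N.

(* Whether the algorithm stops at time t depends only on the relative order,
   under sigma, of the candidates that have arrived up to time t. *)
Definition adapted n (stop : 'S_n.+1 -> 'S_n.+1 -> 'I_n.+1) : Prop :=
  forall (sigma tau sigma' tau' : 'S_n.+1) (t : 'I_n.+1),
    (forall i j : 'I_n.+1, (i <= t)%N -> (j <= t)%N ->
       better sigma (tau i) (tau j) = better sigma' (tau' i) (tau' j)) ->
    (stop sigma tau == t) = (stop sigma' tau' == t).

Record stopping_time n := StoppingTime {
  stop :> 'S_n.+1 -> 'S_n.+1 -> 'I_n.+1;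
  stop_adapted : adapted stop
}.

Definition choice n (M : stopping_time n) (sigma tau : 'S_n.+1) : 'I_n.+1 :=
  tau (M sigma tau).

(* The argument n is the number of candidates here.  The condition 0 < t is
   needed because 0^-1 = 0 in MathComp. *)
Definition small_tail n (t : nat) : bool :=
  (0 < t)%N && (\sum_(t <= s < n) (s%:R : rat)^-1 <= 1).

Lemma small_tail_ex n : exists t, small_tail n t.
Proof.
exists (maxn n 1); rewrite /small_tail leq_max orbT /=.
by rewrite big_geq ?ler01 // leq_maxl.
Qed.

Definition threshold n : nat := ex_minn (small_tail_ex n).

Definition best_so_far n (sigma tau : 'S_n.+1) (k : 'I_n.+1) : bool :=
  [forall (j : 'I_n.+1 | (j <= k)%N), ~~ better sigma (tau j) (tau k)].

(* [enum 'I_n.+1] is increasing, so [head] returns the first admissible time,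
   and the last time when there is none. *)
Definition secretary_stop n (sigma tau : 'S_n.+1) : 'I_n.+1 :=
  head ord_max [seq k : 'I_n.+1 <- enum 'I_n.+1 |
                 (threshold n.+1 <= k.+1)%N && best_so_far sigma tau k].

Lemma secretary_adapted n : adapted (@secretary_stop n).
Proof.
move=> sigma tau sigma' tau' t eq_ord; rewrite /secretary_stop.
set P := fun k : 'I_n.+1 => _ && best_so_far sigma tau k.
set P' := fun k : 'I_n.+1 => _ && best_so_far sigma' tau' k.
have PP' : forall k : 'I_n.+1, (k <= t)%N -> P k = P' k.
  move=> k kt; rewrite /P /P'; congr (_ && _).
  apply: eq_forallb => j; case: (leqP j k) => //= jk.
  by rewrite eq_ord // (leq_trans jk kt).
have st : size (enum 'I_n.+1) = n.+1 by rewrite size_enum_ord.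
rewrite -(cat_take_drop t.+1 (enum 'I_n.+1)) !filter_cat.
have -> : [seq k <- take t.+1 (enum 'I_n.+1) | P k]
        = [seq k <- take t.+1 (enum 'I_n.+1) | P' k].
  apply: eq_in_filter => k kin; apply: PP'.
  have := kin; rewrite -(mem_map val_inj) map_take val_enum_ord take_iota.
  by rewrite mem_iota add0n => /andP[_]; rewrite leq_min => /andP[].
case: (seq.filter P' _) => [|x s] //=.
have late : forall Q : pred 'I_n.+1,
    (head ord_max [seq k <- drop t.+1 (enum 'I_n.+1) | Q k] == t)
    = (t == ord_max).
  move=> Q; case E : [seq k <- _ | _] => [|x s] /=; first by rewrite eq_sym.
  have : x \in [seq k <- drop t.+1 (enum 'I_n.+1) | Q k].
    by rewrite E inE eqxx.
  rewrite mem_filter => /andP[_].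
  rewrite -(mem_map val_inj) map_drop val_enum_ord drop_iota.
  rewrite mem_iota add0n => /andP[tx _].
  have lt_tx : (t < x)%N by [].
  have lt_tn : (t < n)%N by apply: leq_trans lt_tx _; rewrite -ltnS.
  by rewrite -!val_eqE /= (gtn_eqF lt_tx) (ltn_eqF lt_tn).
by rewrite !late.
Qed.

Definition secretary n : stopping_time n := StoppingTime (@secretary_adapted n).

Lemma blind_adapted n : adapted (fun _ _ : 'S_n.+1 => ord0 : 'I_n.+1).
Proof. by []. Qed.

Definition blind n : stopping_time n := StoppingTime (@blind_adapted n).

(* A randomized algorithm draws a seed, independently of the arrival order,
   and then follows the stopping time selected by that seed. *)
Record rand_alg (R : realType) n := RandAlg {
  seed : finType;
  law : seed -> R;
  law_ge0 : forall w, 0 <= law w;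
  law_sum1 : \sum_w law w = 1;
  play : seed -> stopping_time n
}.

Lemma coin_ge0 (R : realType) (p : R) (hp : 0 <= p <= 1) (b : bool) :
  0 <= bernoulli_pmf p b.
Proof. exact: bernoulli_pmf_ge0. Qed.

Lemma coin_sum1 (R : realType) (p : R) : \sum_b bernoulli_pmf p b = 1.
Proof. by rewrite big_bool /bernoulli_pmf /= addrC subrK. Qed.

Definition p_mix (R : realType) n (p : R) (hp : 0 <= p <= 1)
    (M1 M2 : stopping_time n) : rand_alg R n :=
  RandAlg (coin_ge0 hp) (coin_sum1 p) (fun heads => if heads then M1 else M2).

(* The arrival order tau is uniform on 'S_n.+1 and independent of the seed. *)
Definition prob_choice (R : realType) n (M : rand_alg R n) (sigma : 'S_n.+1)
    (S : {set 'I_n.+1}) : R :=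
  \sum_(w : seed M) law w *
    (#|[set tau : 'S_n.+1 | choice (play w) sigma tau \in S]%SET|%:R
     / (n.+1)`!%:R).

(* sel_prob M sigma k is the probability of choosing the k-th best candidate, with k
   counted from 1; it is meant for 1 <= k <= n.+1. *)
Definition sel_prob (R : realType) n (M : rand_alg R n) (sigma : 'S_n.+1) (k : nat)
    : R :=
  prob_choice M sigma [set sigma (inord k.-1)]%SET.

End Algorithms.

Section Distance.

(* rho' is tperm (rho i) (rho j) composed after rho: in MathComp (s * t) x is
   t (s x). *)
Definition swap_step l n (rho rho' : 'S_n.+1) : bool :=
  [exists i : 'I_n.+1, exists j : 'I_n.+1,
    [&& (i < j)%N, (j - i <= l)%N & rho' == (rho * tperm (rho i) (rho j))%g]].

Definition reach l n (k : nat) (rho sigma : 'S_n.+1) : bool :=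
  [exists s : k.-tuple 'S_n.+1, path (@swap_step l n) rho s
                                && (last rho s == sigma)].

(* A shortest chain of swaps repeats no ordering, so it has fewer steps than
   there are orderings and searching below that bound finds the minimum; see
   swap_distP. *)
Definition swap_dist l n (sigma rho : 'S_n.+1) : nat :=
  find (fun k => reach l k rho sigma) (iota 0 #|{perm 'I_n.+1}|).

Lemma swap_step_tperm l n (rho : 'S_n.+1) (i j : 'I_n.+1) :
  (i < j)%N -> (j - i <= l)%N -> swap_step l rho (tperm i j * rho)%g.
Proof.
move=> ij ijl; apply/existsP; exists i; apply/existsP; exists j.
rewrite ij ijl /=; apply/eqP.
by rewrite -tpermJ conjgE !mulgA mulgV mul1g.
Qed.

Lemma connect_tperm l n (rho : 'S_n.+1) (i j : 'I_n.+1) :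
  (0 < l)%N -> connect (@swap_step l n) rho (tperm i j * rho)%g.
Proof.
move=> l0.
wlog : i j / (i <= j)%N.
  move=> H; case: (leqP i j) => [/H //|/ltnW ji].
  by rewrite tpermC; apply: H.
move: {2}(j - i)%N (leqnn (j - i)) => d.
elim: d i j rho => [|d IH] i j rho dij ij.
  have -> : i = j by apply/val_inj/eqP; rewrite eqn_leq ij -subn_eq0 -leqn0.
  by rewrite tperm1 mul1g connect0.
have [jil|ltij] := leqP (j - i) 1.
  have [eij|nij] := eqVneq i j; first by rewrite eij tperm1 mul1g connect0.
  apply: connect1; apply: swap_step_tperm; last exact: leq_trans jil l0.
  by rewrite ltn_neqAle ij andbT.
have lt_ij1 : (i < j.-1)%N by lia.
have Hm : (j.-1 < n.+1)%N by apply: leq_ltn_trans (leq_pred _) (ltn_ord j).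
pose m := Ordinal Hm.
have lt_mj : (m < j)%N by rewrite /=; lia.
have adj r : swap_step l r (tperm m j * r)%g.
  apply: swap_step_tperm => //; apply: leq_trans _ l0 => /=; lia.
have -> : tperm i j = (tperm m j * (tperm i m * tperm m j))%g.
  rewrite -[in LHS](tpermL m j) -[X in tperm X _](@tpermD _ m j i); last 2 first.
  - by rewrite -val_eqE /= gtn_eqF.
  - by rewrite -val_eqE /= gtn_eqF // (leq_trans lt_ij1) // leq_pred.
  by rewrite -tpermJ conjgE tpermV mulgA.
rewrite -!mulgA.
apply: connect_trans (connect1 (adj _)).
apply: connect_trans (connect1 (adj rho)) _.
by apply: IH => //=; lia.
Qed.

Lemma swap_distP l n (sigma rho : 'S_n.+1) : (0 < l)%N ->
  reach l (swap_dist l sigma rho) rho sigma /\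
  forall k, reach l k rho sigma -> (swap_dist l sigma rho <= k)%N.
Proof.
move=> l0.
have conn : connect (@swap_step l n) rho sigma.
  have [ts E _] := prod_tpermP (sigma * rho^-1)%g.
  have -> : sigma = ((\prod_(t <- ts) tperm t.1 t.2)%g * rho)%g.
    by rewrite -E mulgKV.
  elim: ts {E} => [|t ts IH]; first by rewrite big_nil mul1g connect0.
  rewrite big_cons -mulgA; exact: connect_trans IH (connect_tperm _ _ _ l0).
have [k ltk rk] : exists2 k, (k < #|{perm 'I_n.+1}|)%N & reach l k rho sigma.
  case/connectP: conn => p /shortenP[p' pp' up' _] ->.
  exists (size p').
    by have /card_uniqP/= <- := up'; exact: max_card.
  by apply/existsP; exists (in_tuple p') => /=; rewrite pp' eqxx.
pose P k := reach l k rho sigma.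
have hasP : has P (iota 0 #|{perm 'I_n.+1}|).
  by apply/hasP; exists k; rewrite ?mem_iota.
have lt_dist : (swap_dist l sigma rho < #|{perm 'I_n.+1}|)%N.
  by move: hasP; rewrite has_find size_iota.
split.
  by have := nth_find 0%N hasP; rewrite nth_iota // add0n.
move=> j rj; rewrite leqNgt; apply/negP => ltj.
have := before_find 0%N ltj; rewrite nth_iota ?add0n ?rj //.
exact: ltn_trans ltj lt_dist.
Qed.

End Distance.

Section Privacy.

Definition diff_private (R : realType) (l : nat) n (eps delta : R)
    (M : rand_alg R n) : Prop :=
  forall (S : {set 'I_n.+1}) (sigma rho : 'S_n.+1),
    (swap_dist l sigma rho <= 1)%N ->
    prob_choice M sigma S <= expR eps * prob_choice M rho S + delta.

Definition asymp_equiv (R : realType) (f g : nat -> R) : Prop :=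
  (f k / g k) @[k --> \oo] --> (1 : R).

Definition a_tail (R : realType) (m : nat) : R :=
  \big[+%R/0]_(m <= s <oo) (s%:R^-1 * (1 - (expR 1)^-1) ^+ s).

End Privacy.

(* Main.v *)
(* With T candidates rejected outright, the probability that the secretary
   algorithm picks the candidate of rank k (from 0, with n + 1 candidates) is
     T / (n + 1) * (1 / n + G k - [k = 0] / n),
     G k = sum_(T <= j <= n) C(n - k, j) / (j C(n, j)),
   since the best of the first j arrivals is equally likely to be in each of
   the j positions.  The drops of G are
     G (k - 1) - G k = C(n + 1 - T, k) / (k C(n, k)),
   and from this the selection probabilities q of the mix are decreasing and
   log-convex for n >= 6.  Hence q 0 / q l is the largest ratio between ranks at
   distance at most l, which is the worst case for privacy and is attained by
   swapping the ranks 0 and l.  For the limit, T / (n + 1) tends to 1 / e by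
   comparing harmonic sums with ln, G 0 tends to 1, and each drop tends to
   (1 - 1 / e)^k / k; a geometric bound on G identifies what remains with the
   tail of this series. *)
Require Import Defs.
From mathcomp Require Import all_boot all_order all_algebra all_fingroup.
From mathcomp Require Import all_classical all_reals all_analysis.
From mathcomp Require Import zify ring lra.

Import Order.TTheory GRing.Theory Num.Theory.
Import numFieldNormedType.Exports.

Local Open Scope ring_scope.
Local Open Scope classical_set_scope.

(** * Counting arrival orders *)

Section CountingPermutations.
Set Implicit Arguments.
Unset Strict Implicit.
Local Open Scope nat_scope.
Variable n : nat.

(** In these counts [pi] sends an arrival time to the rank of the candidate arriving then, 0 being
    the best. A sum of indicators, unlike a cardinality, can be reindexed by translations and
    exchanged with other sums directly. *)
Definition nperm (P : 'S_n.+1 -> bool) : nat := \sum_pi P pi.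

Lemma eq_nperm (P Q : 'S_n.+1 -> bool) : P =1 Q -> nperm P = nperm Q.
Proof. by move=> PQ; apply: eq_bigr => pi _; rewrite PQ. Qed.

Lemma nperm_mull (s : 'S_n.+1) (P : 'S_n.+1 -> bool) :
  nperm (fun pi => P (s * pi)%g) = nperm P.
Proof. by rewrite [RHS](reindex_inj (mulgI s)). Qed.

Lemma nperm_mulr (s : 'S_n.+1) (P : 'S_n.+1 -> bool) :
  nperm (fun pi => P (pi * s)%g) = nperm P.
Proof. by rewrite [RHS](reindex_inj (mulIg s)). Qed.

Lemma exchange_nperm (I : finType) (A : pred I) (P : I -> 'S_n.+1 -> bool) :
  \sum_(i | A i) nperm (P i) = \sum_pi \sum_(i | A i) P i pi.
Proof. exact: exchange_big. Qed.

Lemma nperm_fix (i k : 'I_n.+1) : nperm (fun pi => pi i == k) = n`!.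
Proof.
have eqk j : nperm (fun pi => pi i == j) = nperm (fun pi => pi i == k).
  rewrite -(nperm_mulr (tperm j k)); apply: eq_nperm => pi.
  by rewrite permM -(inj_eq (@perm_inj _ (tperm j k))) tpermL tpermK.
have : \sum_j nperm (fun pi => pi i == j) = n.+1`!.
  rewrite (exchange_nperm predT (fun j pi => pi i == j)).
  rewrite (eq_bigr (fun=> 1)) => [|pi _]; first by rewrite sum1_card card_Sn.
  rewrite (bigD1 (pi i)) //= eqxx big1 // => j.
  by rewrite eq_sym => /negPf ->.
under eq_bigr => j _ do rewrite eqk.
by rewrite sum_nat_const card_ord factS => /eqP; rewrite eqn_pmul2l // => /eqP.
Qed.

Definition above (j : nat) (k : 'I_n.+1) (pi : 'S_n.+1) : bool :=
  [forall i : 'I_n.+1, (i < j) ==> (k < pi i)].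

Lemma aboveP (j : nat) (k : 'I_n.+1) (pi : 'S_n.+1) :
  reflect (forall i : 'I_n.+1, i < j -> k < pi i) (above j k pi).
Proof.
by apply: (iffP forallP) => [H i ij|H i]; [move: (H i); rewrite ij|apply/implyP/H].
Qed.

Lemma above_tperm j (k a b : 'I_n.+1) pi : (a < j) = (b < j) ->
  above j k (tperm a b * pi)%g = above j k pi.
Proof.
move=> ab; have H s : above j k s -> above j k (tperm a b * s)%g.
  move/aboveP=> Hs; apply/aboveP=> i ij; rewrite permM; apply: Hs.
  by case: tpermP ij => [->|->|//]; rewrite ab.
apply/idP/idP => [/H|/H //]; by rewrite mulgA tperm2 mul1g.
Qed.

Lemma sum_ord_itv a b : b <= n.+1 -> \sum_(i < n.+1) ((a <= i) && (i < b)) = b - a.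
Proof.
move=> bn; rewrite -(big_mkord predT (fun i => ((a <= i) && (i < b)) : nat)).
elim: b bn => [|b IH] bn.
  by rewrite big1 ?sub0n // => i _; rewrite ltn0 andbF.
transitivity (\sum_(0 <= i < n.+1) (((a <= i) && (i < b)) + ((i == b) && (a <= b)))).
  apply: eq_bigr => i _; rewrite ltnS [i <= b]leq_eqVlt.
  by case: eqVneq => [->|] /=; rewrite ?ltnn ?andbF ?andbT ?addn0.
rewrite big_split /= (IH (ltnW bn)) (bigD1_seq b) ?iota_uniq //=; last first.
  by rewrite mem_index_iota.
rewrite eqxx /= big1 ?addn0 => [|i /negPf -> //].
by case: leqP; lia.
Qed.

(** Double counting of the pairs of an order [pi] and a time [i] with [j <= i < n] at which the rank
    is worse than [k]. Exchanging the times [i] and [j] gives the left side; counting the [i] for a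
    fixed [pi] gives the right side. *)
Lemma nperm_above_rec (j : nat) (k : 'I_n.+1) : j < n ->
  nperm (fun pi => (pi ord_max == k) && above j.+1 k pi) * (n - j)
  = nperm (fun pi => (pi ord_max == k) && above j k pi) * (n - k - j).
Proof.
move=> jn.
pose A := [pred i : 'I_n.+1 | (j <= i) && (i < n)].
pose P i (pi : 'S_n.+1) := [&& pi ord_max == k, above j k pi & k < pi i].
have jn1 : j < n.+1 by lia.
pose jo := Ordinal jn1.
have PE i : A i -> nperm (P i) = nperm (fun pi => (pi ord_max == k) && above j.+1 k pi).
  case/andP=> ji ilt; rewrite -[LHS](nperm_mull (tperm i jo)).
  apply: eq_nperm => pi; rewrite /P !permM tpermL above_tperm; last first.
    by rewrite /= ltnn; lia.
  rewrite tpermD ?(eq_sym _ ord_max) -?val_eqE /=; try lia.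
  congr (_ && _); apply/andP/aboveP => [[/aboveP H kj] a|H].
    rewrite ltnS leq_eqVlt => /orP[/eqP aj|/H //].
    by rewrite (_ : a = jo) //; apply: val_inj.
  by split; [apply/aboveP => a aj; apply: H; lia | apply: H].
transitivity (\sum_(i | A i) nperm (P i)).
  rewrite (eq_bigr _ PE) sum_nat_const mulnC; congr (_ * _).
  rewrite -sum1_card big_mkcond /=.
  by rewrite -(@sum_ord_itv j n) //; apply: eq_bigr => i _; case: ifP.
rewrite exchange_nperm big_distrl /=; apply: eq_bigr => pi _.
rewrite /P; case: eqP => [pn|_] /=; last by rewrite big1.
case: aboveP => [ab|_] /=; last by rewrite big1.
rewrite mul1n.
(* Of the [n - k] ranks worse than [k], the first [j] times use up [j], and the last time uses none
   since it holds [k] itself. *)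
have : \sum_i (k < pi i) = n - k.
  rewrite -[RHS](subSS) -(@sum_ord_itv k.+1 n.+1) //.
  rewrite (reindex_inj (@perm_inj _ pi^-1%g)) /=.
  by apply: eq_bigr => i _; rewrite permKV ltn_ord andbT.
rewrite (bigID A) /= [X in _ + X](_ : _ = j); first by move <-; rewrite addnK.
rewrite -[RHS]subn0 -(@sum_ord_itv 0 j) ?(ltnW jn1) //.
rewrite big_mkcond; apply: eq_bigr => i _ /=.
case: (ltnP i j) => ij /=; first by rewrite ab.
case: ifP => // ni; rewrite (_ : i = ord_max) ?pn ?ltnn //.
by apply: val_inj => /=; have := ltn_ord i; lia.
Qed.

(** The quotient C(n - k, j) / C(n, j) starts at 1 and obeys the recursion of [nperm_above_rec]. *)
Lemma nperm_above_max (j : nat) (k : 'I_n.+1) : j <= n ->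
  nperm (fun pi => (pi ord_max == k) && above j k pi) * 'C(n, j) = n`! * 'C(n - k, j).
Proof.
elim: j => [|j IH] jn.
  rewrite !bin0 !muln1 -(nperm_fix ord_max k).
  by apply: eq_nperm => pi; rewrite (introT (aboveP _ _ _)) ?andbT.
apply/eqP; rewrite -(eqn_pmul2l (ltn0Sn j)); apply/eqP.
have := IH (ltnW jn); have := nperm_above_rec k jn.
have := mul_bin_left n j; have := mul_bin_left (n - k) j.
move=> e1 e2 e3 e4.
by rewrite mulnCA e2 [in RHS]mulnCA e1 mulnA e3 mulnAC e4 mulnAC -mulnA.
Qed.

(** Exchanging time [j] with the last time leaves the times before [j] alone, so [nperm_above_max]
    applies. *)
Lemma nperm_above (j k : 'I_n.+1) :
  nperm (fun pi => (pi j == k) && above j k pi) * 'C(n, j) = n`! * 'C(n - k, j).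
Proof.
rewrite -nperm_above_max -1?ltnS //; congr (_ * _).
rewrite -[RHS](nperm_mull (tperm j ord_max)); apply: eq_nperm => pi.
rewrite permM tpermR; congr (_ && _).
apply/aboveP/aboveP => H i ij.
  rewrite permM tpermD; first exact: H.
    by rewrite -val_eqE /=; lia.
  by rewrite -val_eqE /=; have := ltn_ord j; lia.
have := H i ij; rewrite permM tpermD //.
  by rewrite -val_eqE /=; lia.
by rewrite -val_eqE /=; have := ltn_ord j; lia.
Qed.

Definition prefix_min (j : nat) (i : 'I_n.+1) (pi : 'S_n.+1) : bool :=
  [forall a : 'I_n.+1, (a < j) ==> (pi i <= pi a)].

Lemma prefix_minP (j : nat) (i : 'I_n.+1) (pi : 'S_n.+1) :
  reflect (forall a : 'I_n.+1, a < j -> pi i <= pi a) (prefix_min j i pi).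
Proof.
by apply: (iffP forallP) => [H a ij|H a]; [move: (H a); rewrite ij|apply/implyP/H].
Qed.

Lemma sum_prefix_min (j : nat) (pi : 'S_n.+1) : 0 < j <= n.+1 ->
  \sum_(i : 'I_n.+1 | i < j) prefix_min j i pi = 1.
Proof.
case/andP=> j0 jn.
case: (@arg_minnP _ ord0 (fun i : 'I_n.+1 => i < j) (fun i => val (pi i)) j0) => i ij imin.
rewrite (bigD1 i) //= (introT (prefix_minP _ _ _)) ?big1 // => a /andP[aj ai].
apply/eqP; rewrite eqb0; apply/negP => /prefix_minP /(_ i ij) le1.
have le2 := imin a aj; case/eqP: ai; apply: (@perm_inj _ pi); apply: val_inj.
by apply/eqP; rewrite eqn_leq le1 le2.
Qed.

(** Permuting the first [j] times preserves the conditions on [k], so each of these times holds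
    their best rank equally often, and [T] of them are favourable. *)
Lemma nperm_early_min (T : nat) (j k : 'I_n.+1) : 0 < T <= j ->
  j * nperm (fun pi => [&& pi j == k, above j k pi
                        & [exists i : 'I_n.+1, (i < T) && prefix_min j i pi]])
  = T * nperm (fun pi => (pi j == k) && above j k pi).
Proof.
case/andP=> T0 Tj.
pose P i (pi : 'S_n.+1) := [&& pi j == k, above j k pi & prefix_min j i pi].
have Psym (a b : 'I_n.+1) : a < j -> b < j -> nperm (P a) = nperm (P b).
  move=> aj bj; rewrite -[LHS](nperm_mull (tperm a b)); apply: eq_nperm => pi.
  rewrite /P permM tpermD; [|by rewrite -val_eqE /=; lia..].
  rewrite above_tperm ?aj ?bj //; do 2!congr (_ && _).
  apply/prefix_minP/prefix_minP => H i ij.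
    by have := H (tperm a b i); rewrite !permM tpermL tpermK; apply; case: tpermP ij => // ->.
  by rewrite !permM tpermL; apply: H; case: tpermP ij => // ->.
have sumP m : 0 < m <= j -> \sum_(i : 'I_n.+1 | i < m) nperm (P i) = m * nperm (P ord0).
  case/andP=> m0 mj.
  rewrite (eq_bigr (fun=> nperm (P ord0))) => [|i im]; last first.
    by apply: Psym => /=; lia.
  rewrite sum_nat_const; congr (_ * _); rewrite -sum1_card big_mkcond /=.
  rewrite -[RHS]subn0 -(@sum_ord_itv 0 m) ?(leq_trans mj (ltnW (ltn_ord j))) //.
have j0 : 0 < j by lia.
have -> : nperm (fun pi => (pi j == k) && above j k pi) = j * nperm (P ord0).
  rewrite -sumP ?j0 ?leqnn // exchange_nperm; apply: eq_bigr => pi _.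
  rewrite /P; case: (_ && _) / andP => [[-> ->]|ne] /=.
    by rewrite sum_prefix_min // j0 ltnW.
  by rewrite big1 // => i _; apply/eqP; rewrite eqb0 andbA; apply/negP => /andP[/andP].
rewrite mulnCA; congr (_ * _); rewrite -sumP ?T0 ?Tj // exchange_nperm.
apply: eq_bigr => pi _; rewrite /P.
case: (pi j == k) => /=; last by rewrite big1.
case: (above j k pi) => /=; last by rewrite big1.
(* The prefix minimum is unique, so the truth value of its existence before [T] equals a sum of
   indicators. *)
have S1 := sum_prefix_min pi (introT andP (conj j0 (ltnW (ltn_ord j)))).
case: existsP => [[i /andP[iT im]]|ne] /=; last first.
  by rewrite big1 // => i iT; apply/eqP; rewrite eqb0; apply/negP => im; case: ne; exists i; rewrite iT.
rewrite (bigD1 i) //= im big1 // => a /andP[aT ai].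
move: S1; rewrite (bigD1 i) /=; last by lia.
rewrite im => /eqP; rewrite -[X in _ == X]addn0 eqn_add2l sum_nat_eq0 => /forallP /(_ a).
by rewrite ai (leq_trans aT Tj) => /eqP.
Qed.

(** Once rank [k] sits at time [j], the [n] other times hold rank [r] equally often. *)
Lemma nperm_two (i j k r : 'I_n.+1) : i != j -> k != r ->
  n * nperm (fun pi => (pi j == k) && (pi i == r)) = n`!.
Proof.
move=> ij kr.
have Psym (a b : 'I_n.+1) : a != j -> b != j ->
    nperm (fun pi => (pi j == k) && (pi a == r)) = nperm (fun pi => (pi j == k) && (pi b == r)).
  move=> aj bj; rewrite -[LHS](nperm_mull (tperm a b)); apply: eq_nperm => pi.
  by rewrite !permM tpermL tpermD.
rewrite -(nperm_fix j k).
transitivity (\sum_(a | a != j) nperm (fun pi => (pi j == k) && (pi a == r))).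
  rewrite (eq_bigr (fun=> nperm (fun pi => (pi j == k) && (pi i == r)))) => [|a aj].
    by rewrite sum_nat_const cardC1 card_ord.
  exact: Psym.
rewrite exchange_nperm; apply: eq_bigr => pi _.
case: eqP => [pj|_] /=; last by rewrite big1.
have pr : (pi^-1)%g r != j.
  by apply: contra kr => /eqP e; rewrite -pj -e permKV.
rewrite (bigD1 ((pi^-1)%g r)) //= permKV eqxx big1 // => a /andP[_ ne].
by apply/eqP; rewrite eqb0; apply: contra ne => /eqP <-; rewrite permK.
Qed.
End CountingPermutations.

(** * Binomial estimates *)

Section Binomials.
Set Implicit Arguments.
Unset Strict Implicit.
Local Open Scope nat_scope.

Lemma sum_bin_col (n k T : nat) : T <= n.+1 ->
  \sum_(T <= j < n.+1) 'C(n - j, k) = 'C(n.+1 - T, k.+1).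
Proof.
move=> Tn; have [d dE] : exists d, d = n.+1 - T by exists (n.+1 - T).
elim: d T Tn dE => [|d IH] T Tn dE; first by rewrite big_geq -?dE //; lia.
have -> : n.+1 - T = (n - T).+1 by lia.
rewrite big_ltn; last by lia.
by rewrite IH ?subSS 1?addnC //; lia.
Qed.

(** Both sides are the multinomial coefficient N! / (k! i! (N - k - i)!), or 0 when [k + i] exceeds
    [N]. *)
Lemma mul_bin_swap (N k i : nat) : 'C(N, k) * 'C(N - k, i) = 'C(N, i) * 'C(N - i, k).
Proof.
have [ki|ki] := leqP (k + i) N; last first.
  have zero a b : N < a + b -> 'C(N, a) * 'C(N - a, b) = 0.
    move=> ab; have [Na|aN] := ltnP N a; first by rewrite bin_small.
    by rewrite [X in _ * X]bin_small ?muln0 //; lia.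
  by rewrite !zero // addnC.
have kN : k <= N by lia. have iN : i <= N by lia.
have e1 := bin_fact kN; have e2 := bin_fact iN.
have e3 : 'C(N - k, i) * (i`! * (N - k - i)`!) = (N - k)`! by apply: bin_fact; lia.
have e4 : 'C(N - i, k) * (k`! * (N - i - k)`!) = (N - i)`! by apply: bin_fact; lia.
have e5 : N - i - k = N - k - i by lia.
have P : 0 < k`! * i`! * (N - k - i)`! by rewrite !muln_gt0 !fact_gt0.
apply/eqP; rewrite -(eqn_pmul2r P); apply/eqP.
transitivity N`!; first by rewrite -e1 -e3; ring.
by rewrite -e2 -e4 e5; ring.
Qed.

Lemma mul_bin_mid (n k j : nat) : k < n -> 0 < j ->
  'C(n - k.+1, j.-1) * (k.+1 * 'C(n, k.+1)) = 'C(n - j, k) * (j * 'C(n, j)).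
Proof.
case: n j => [|n] [|j] // _ _; rewrite -!mul_bin_diag !subSS.
by have := mul_bin_swap n k j; rewrite /=; nia.
Qed.

(** Raising [K] by one multiplies the binomials by (S - K) / (K + 1) and (S + v - K) / (K + 1). The
    bound on [S - K] says that K (S - K) <= (K - 1) (S + v - K), which pays for the growth of the
    left factor from K - 1 to K. *)
Lemma bin_growth_step (S v K : nat) : 1 < K -> S - K <= K.-1 * v ->
  K.-1 * 'C(S, K) <= 'C(S + v, K) -> K * 'C(S, K.+1) <= 'C(S + v, K.+1).
Proof.
move=> K1 hS IH; case: (leqP S K) => [SK|KS]; first by rewrite bin_small // muln0.
rewrite -(leq_pmul2l (ltn0Sn K)).
have e1 := mul_bin_left S K; have e2 := mul_bin_left (S + v) K.
rewrite mulnCA e1 e2.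
have K0 : 0 < K.-1 by lia.
rewrite -(leq_pmul2l K0).
apply: (@leq_trans (K * (S - K) * 'C(S + v, K))).
  rewrite [X in X <= _](_ : _ = K * (S - K) * (K.-1 * 'C(S, K))); last by ring.
  by rewrite leq_mul2l IH orbT.
by rewrite mulnA leq_mul2r; apply/orP; right; nia.
Qed.

(** This is [bin_growth] at K = 3, with s = S - 3 and v = u - 1. Small [s] reduces to v = 3; for
    larger [s], 2 v >= s - 2 leaves a polynomial inequality in [s] alone. *)
Lemma ffact3_growth (s v : nat) : 2 < v -> s <= v.*2 + 2 ->
  2 * ((s + 3) * (s + 2) * (s + 1)) <= (s + v + 3) * (s + v + 2) * (s + v + 1).
Proof.
move=> v2 sv; have [s8|s9] := leqP s 8.
  apply: (@leq_trans ((s + 3 + 3) * (s + 3 + 2) * (s + 3 + 1))); last first.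
    by apply: leq_mul; [apply: leq_mul|]; lia.
  by move: s s8 {sv}; do 9!case=> //.
rewrite -(leq_pmul2l (isT : 0 < 8)).
apply: (@leq_trans ((3 * s + 4) * (3 * s + 2) * (3 * s))).
  by rewrite -(subnK s9); set z := s - 9; nia.
rewrite [X in _ <= X](_ : _ = (2 * (s + v + 3)) * (2 * (s + v + 2)) * (2 * (s + v + 1))); last by ring.
by apply: leq_mul; [apply: leq_mul|]; lia.
Qed.

Lemma ffact4_growth (s v : nat) : 2 < v -> s <= v.*2 + 1 ->
  3 * ((s + 4) * (s + 3) * (s + 2) * (s + 1))
  <= (s + v + 4) * (s + v + 3) * (s + v + 2) * (s + v + 1).
Proof.
move=> v2 sv; have [s7|s8] := leqP s 7.
  apply: (@leq_trans ((s + 3 + 4) * (s + 3 + 3) * (s + 3 + 2) * (s + 3 + 1))); last first.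
    by apply: leq_mul; [apply: leq_mul; [apply: leq_mul|]|]; lia.
  by move: s s7 {sv}; do 8!case=> //.
rewrite -(leq_pmul2l (isT : 0 < 16)).
apply: (@leq_trans ((3 * s + 7) * (3 * s + 5) * (3 * s + 3) * (3 * s + 1))).
  by rewrite -(subnK s8); set z := s - 8; nia.
rewrite [X in _ <= X](_ : _ = (2 * (s + v + 4)) * (2 * (s + v + 3)) *
  (2 * (s + v + 2)) * (2 * (s + v + 1))); last by ring.
by apply: leq_mul; [apply: leq_mul; [apply: leq_mul|]|]; lia.
Qed.

Lemma bin_growth (u K S : nat) : 3 < u -> 1 < K -> S <= u.*2 + 3 ->
  K.-1 * 'C(S, K) <= 'C(S + u.-1, K).
Proof.
move=> u3 + Su; case: K => [|[|K]] // _.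
(* [bin_growth_step] needs S - K <= (K - 1) (u - 1), which S <= 2 u + 3 guarantees only from K = 4
   on; hence the base cases 2, 3 and 4. *)
elim: K => [|[|[|K]] IH].
- by rewrite mul1n leq_bin2l // leq_addr.
- have [?|S3] := ltnP S 3; first by rewrite bin_small.
  rewrite -(leq_pmul2r (fact_gt0 3)) -mulnA !bin_ffact.
  have -> : S ^_ 3 = (S - 3 + 3) * (S - 3 + 2) * (S - 3 + 1).
    by rewrite !ffactnS ffactn0 muln1 mulnA; congr (_ * _ * _); lia.
  have -> : (S + u.-1) ^_ 3 = (S - 3 + u.-1 + 3) * (S - 3 + u.-1 + 2) * (S - 3 + u.-1 + 1).
    by rewrite !ffactnS ffactn0 muln1 mulnA; congr (_ * _ * _); lia.
  by apply: ffact3_growth; lia.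
- have [?|S4] := ltnP S 4; first by rewrite bin_small.
  rewrite -(leq_pmul2r (fact_gt0 4)) -mulnA !bin_ffact.
  have -> : S ^_ 4 = (S - 4 + 4) * (S - 4 + 3) * (S - 4 + 2) * (S - 4 + 1).
    by rewrite !ffactnS ffactn0 muln1 !mulnA; congr (_ * _ * _ * _); lia.
  have -> : (S + u.-1) ^_ 4 = (S - 4 + u.-1 + 4) * (S - 4 + u.-1 + 3) *
      (S - 4 + u.-1 + 2) * (S - 4 + u.-1 + 1).
    by rewrite !ffactnS ffactn0 muln1 !mulnA; congr (_ * _ * _ * _); lia.
  by apply: ffact4_growth; lia.
- by apply: bin_growth_step IH => //=; nia.
Qed.

(* The hypothesis [w.+1 * (w + u) < K ^ 2 * u] says that the ratio of the
   consecutive drops [wdrop] below decreases at [K]. *)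
Lemma past_peak (u w K : nat) : 0 < u -> 1 < K -> w + K <= u.*2 + 3 ->
  w.+1 * (w + u) < K ^ 2 * u ->
  (w + K + u) * 'C(w + K, K) * (K.-1 * w.+1) <= K * 'C(w + K + u, K) * (w.+1 + K * u).
Proof.
move=> u0 K1 wK pk; have [u3|u4] := leqP u 3.
  (* A finite check where [bin_growth] does not apply: [u <= 3] forces [w + K <= 9], hence [w <= 7]
     and [2 <= K <= 9]. *)
  have H : all (fun u => all (fun w => all (fun K =>
      [&& w + K <= u.*2 + 3 & w.+1 * (w + u) < K ^ 2 * u] ==>
      ((w + K + u) * 'C(w + K, K) * (K.-1 * w.+1)
        <= K * 'C(w + K + u, K) * (w.+1 + K * u)))
      (iota 2 8)) (iota 0 8)) (iota 1 3) by vm_compute.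
  move/allP: H => /(_ u); rewrite mem_iota u0 ltnS u3 => /(_ isT).
  have w7 : w < 8 by lia.
  move/allP => /(_ w); rewrite mem_iota w7 => /(_ isT).
  have K10 : K < 10 by lia.
  by move/allP => /(_ K); rewrite mem_iota K1 K10 wK pk => /(_ isT) /implyP; apply.
have g := bin_growth u4 K1 (wK : w + K <= _).
have wu0 : 0 < w + u by lia.
have e := mul_bin_down (w + K + u) K.
have e2 : (w + K + u).-1 = w + K + u.-1 by lia.
have e3 : w + K + u - K = w + u by lia.
rewrite e2 e3 in e.
(* The factor [w + u] lowers the upper index of C(w + K + u, K) by one, to the form bounded by
   [bin_growth]. *)
rewrite -(leq_pmul2l wu0).
rewrite [X in _ <= X](_ : _ = (w + K + u) * (K * (w.+1 + K * u) * 'C(w + K + u.-1, K))); last first.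
  by transitivity (K * (w.+1 + K * u) * ((w + u) * 'C(w + K + u, K))); [ring|rewrite -e; ring].
rewrite [X in X <= _](_ : _ = (w + K + u) * (w.+1 * (w + u) * (K.-1 * 'C(w + K, K)))); last by ring.
rewrite leq_mul2l; apply/orP; right; apply: leq_mul g.
by apply: leq_trans (ltnW pk) _; rewrite expnS expn1; nia.
Qed.
End Binomials.

(** * Log-convexity of the selection probabilities *)

Section SelectionWeights.
Set Implicit Arguments.
Unset Strict Implicit.
Variable R : realFieldType.
Implicit Types n m k T : nat.

(** This is [G] of the overview; [wdrop] is its drop from [k - 1] to [k] when [m] is [n + 1 - T]. *)
Definition weight n T k : R :=
  \sum_(T <= j < n.+1) 'C(n - k, j)%:R / (j%:R * 'C(n, j)%:R).

Definition wdrop n m k : R := 'C(m, k)%:R / (k%:R * 'C(n, k)%:R).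

Lemma binR_gt0 n k : (k <= n)%N -> (0 : R) < 'C(n, k)%:R.
Proof. by rewrite ltr0n bin_gt0. Qed.

Lemma wdrop_ge0 n m k : 0 <= wdrop n m k.
Proof. by rewrite divr_ge0 ?mulr_ge0. Qed.

Lemma weight_ge0 n T k : 0 <= weight n T k.
Proof. by apply: sumr_ge0 => j _; rewrite divr_ge0 ?mulr_ge0. Qed.

Lemma weight0 n T : weight n T 0 = \sum_(T <= j < n.+1) j%:R^-1.
Proof.
apply: eq_big_nat => j /andP[_ jn]; rewrite subn0 invfM mulrCA divff ?mulr1 //.
by rewrite gt_eqF ?binR_gt0.
Qed.

(** [sum_bin_col] spreads the drop over the terms [j], and [mul_bin_mid] makes each term an instance
    of Pascal's rule. *)
Lemma weightS n T k : (0 < T <= n.+1)%N -> (k < n)%N ->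
  weight n T k = weight n T k.+1 + wdrop n (n.+1 - T) k.+1.
Proof.
move=> /andP[T0 Tn] kn; rewrite /wdrop -sum_bin_col // natr_sum mulr_suml -big_split /=.
apply: eq_big_nat => j /andP[Tj jn].
have j0 : (0 < j)%N by lia.
have b1 : ('C(n, k.+1)%:R : R) != 0 by rewrite gt_eqF ?binR_gt0.
have b2 : ('C(n, j)%:R : R) != 0 by rewrite gt_eqF ?binR_gt0.
have j1 : (j%:R : R) != 0 by rewrite pnatr_eq0; lia.
have k1 : (k.+1%:R : R) != 0 by rewrite pnatr_eq0.
have mid : 'C(n - k.+1, j.-1)%:R * (k.+1%:R * 'C(n, k.+1)%:R)
    = 'C(n - j, k)%:R * (j%:R * 'C(n, j)%:R) :> R.
  by rewrite -!natrM mul_bin_mid.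
have -> : 'C(n - j, k)%:R / (k.+1%:R * 'C(n, k.+1)%:R)
    = 'C(n - k.+1, j.-1)%:R / (j%:R * 'C(n, j)%:R) :> R.
  apply/eqP; rewrite eqr_div ?mulf_neq0 //; apply/eqP; by rewrite mid.
rewrite -mulrDl -natrD; congr (_%:R / _).
have -> : (n - k = (n - k.+1).+1)%N by lia.
by case: (j) j0 => // i _; rewrite binS.
Qed.

Lemma wdropS n w K : (0 < K)%N -> (K < n)%N ->
  wdrop n (w + K) K.+1 * (K.+1%:R * (n - K)%:R) = wdrop n (w + K) K * (K%:R * w%:R).
Proof.
move=> K0 Kn; rewrite /wdrop.
have e1 := mul_bin_left (w + K) K; have e2 := mul_bin_left n K.
rewrite addnK in e1.
have b1 := binR_gt0 Kn; have b2 := binR_gt0 (ltnW Kn).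
have k0 : (0 : R) < K%:R by rewrite ltr0n.
have k1 : (0 : R) < K.+1%:R by rewrite ltr0n.
have {e1} e1 : K.+1%:R * 'C(w + K, K.+1)%:R = w%:R * 'C(w + K, K)%:R :> R.
  by rewrite -!natrM e1.
have {e2} e2 : K.+1%:R * 'C(n, K.+1)%:R = (n - K)%:R * 'C(n, K)%:R :> R.
  by rewrite -!natrM e2.
have nk : (0 : R) < (n - K)%:R by rewrite ltr0n subn_gt0.
have {}e1 : 'C(w + K, K.+1)%:R = w%:R * 'C(w + K, K)%:R / K.+1%:R :> R.
  by rewrite -e1 mulrC mulKf ?gt_eqF.
have {}e2 : 'C(n, K.+1)%:R = (n - K)%:R * 'C(n, K)%:R / K.+1%:R :> R.
  by rewrite -e2 mulrC mulKf ?gt_eqF.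
rewrite e1 e2; field.
by rewrite !gt_eqF //; lra.
Qed.

Lemma wdrop_small n m k : (m < k)%N -> wdrop n m k = 0.
Proof. by move=> mk; rewrite /wdrop bin_small // mul0r. Qed.

Lemma wdrop_past_peak u w K : (0 < u)%N -> (1 < K)%N ->
  (w + K <= u.*2 + 3)%N -> (w.+1 * (w + u) < K ^ 2 * u)%N ->
  wdrop (w + K + u) (w + K) K * (K.-1%:R * w.+1%:R / (w.+1%:R + K%:R * u%:R))
  <= (w + K + u)%:R^-1.
Proof.
move=> u0 K1 wK pk; have := past_peak u0 K1 wK pk.
set W := (w + K)%N; set n := (W + u)%N => pp.
have b : (0 : R) < 'C(n, K)%:R by apply: binR_gt0; lia.
have k0 : (0 : R) < K%:R by rewrite ltr0n; lia.
have n0 : (0 : R) < n%:R by rewrite ltr0n; lia.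
have w0 : (0 : R) < w.+1%:R by rewrite ltr0n.
have d0 : (0 : R) < w.+1%:R + K%:R * u%:R by rewrite ltr_wpDr // mulr_ge0.
rewrite /wdrop mulf_div ler_pdivrMr ?mulr_gt0 // [leRHS]mulrC ler_pdivlMr //.
by move: pp; rewrite -(ler_nat R) !(natrM, natrD); lra.
Qed.

(* The factor [(K - 1) (w + 1) / (w + 1 + K u)] is [r / (1 - r)] for the ratio
   [r] of [wdrop] at [K] and [K - 1].  While [r] increases with [K] the bound is
   inherited from [K + 1]; once [r] decreases, [1 / n] alone suffices. *)
Lemma wdrop_le_tail u w K : (0 < u)%N -> (1 < K)%N ->
  (w + K <= u.*2 + 3)%N ->
  wdrop (w + K + u) (w + K) K * (K.-1%:R * w.+1%:R / (w.+1%:R + K%:R * u%:R))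
  <= (w + K + u)%:R^-1 + weight (w + K + u) u.+1 K.
Proof.
move=> u0; elim: w K => [|w IH] K K1 wK.
  by rewrite ler_wpDr ?weight_ge0 // wdrop_past_peak //; nia.
have [pk|inc] := ltnP (w.+2 * (w.+1 + u))%N (K ^ 2 * u).
  by rewrite ler_wpDr ?weight_ge0 // wdrop_past_peak.
have := IH K.+1 (ltnW K1); rewrite -addSnnS => /(_ wK).
rewrite (weightS (k := K)); [|lia|lia].
rewrite (_ : (_.+1 - u.+1 = w.+1 + K)%N); last by lia.
have := @wdropS (w.+1 + K + u) w.+1 K; rewrite (_ : (_ + u - K = w.+1 + u)%N); last by lia.
move=> /(_ (ltnW K1)); rewrite (_ : (K < _)%N); last by lia.
move=> /(_ isT); set D' := wdrop _ _ K.+1; set D := wdrop _ _ K.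
have D0 : 0 <= D := wdrop_ge0 _ _ _.
set n := (w.+1 + K + u)%N; set G := weight _ _ _.
rewrite natrD /=.
have a1 : (1 : R) <= w.+1%:R by rewrite ler1n.
have k2 : (2 : R) <= K%:R by rewrite ler_nat.
have u1 : (1 : R) <= u%:R by rewrite ler1n.
rewrite -[w.+2%:R]natr1 -[K.+1%:R]natr1 (_ : K.-1%:R = K%:R - 1 :> R); last first.
  by rewrite -[in RHS](prednK (ltnW K1)) -natr1 addrK.
have : (K%:R ^+ 2 * u%:R : R) <= (w.+1%:R + 1) * (w.+1%:R + u%:R).
  by rewrite natr1 -natrX -natrD -!natrM ler_nat.
move: (w.+1%:R : R) (K%:R : R) (u%:R : R) a1 k2 u1 => a k v a1 k2 v1 incR DD' IHR.
have d1 : 0 < a + (k + 1) * v by nra.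
have d2 : 0 < a + 1 + k * v by nra.
have D'E : D' + D' * (k * a / (a + (k + 1) * v)) = D * (k * a / (a + (k + 1) * v)).
  have -> : D' + D' * (k * a / (a + (k + 1) * v))
    = (D' * ((k + 1) * (a + v))) / (a + (k + 1) * v) by field; rewrite gt_eqF.
  by rewrite DD' -[LHS]mulrA.
(* After clearing denominators the difference of the two sides is (a + 1) (a + v) - k^2 v,
   nonnegative by [incR]. *)
have xx : (k - 1) * (a + 1) / (a + 1 + k * v) <= k * a / (a + (k + 1) * v).
  rewrite ler_pdivrMr // mulrAC ler_pdivlMr //; nra.
have := ler_wpM2l D0 xx; lra.
Qed.

(** Let Q be [c] plus the weight at [k], and D, D' the drops into and out of [k]. Log-convexity, Q^2
    <= (Q + D) (Q - D'), rearranges to this inequality, which comes from [wdrop_le_tail] at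
    [k + 1]. *)
Lemma weight_log_convex_step u m k (c : R) : (0 < u)%N -> (m <= u.*2 + 3)%N ->
  (0 < k < m + u)%N -> (m + u)%:R^-1 <= c ->
  wdrop (m + u) m k * wdrop (m + u) m k.+1
  <= (c + weight (m + u) u.+1 k) * (wdrop (m + u) m k - wdrop (m + u) m k.+1).
Proof.
move=> u0 mu /andP[k0 kn] hc.
have W0 := weight_ge0 (m + u) u.+1 k.
have c0 : 0 <= c by apply: le_trans hc; rewrite invr_ge0.
have [km|mk] := ltnP k m; last first.
  by rewrite (@wdrop_small _ _ k.+1) // mulr0 subr0 mulr_ge0 ?wdrop_ge0 // addr_ge0.
have [w mE] : exists w, m = (w + k.+1)%N by exists (m - k.+1)%N; lia.
have := @wdrop_le_tail u w k.+1 u0; rewrite -mE => /(_ k0 mu) /=.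
have := @wdropS (m + u) w.+1 k; rewrite addSnnS -mE (_ : (m + u - k = w.+1 + u)%N); last by lia.
move=> /(_ k0 kn).
rewrite (weightS (k := k)); [|lia|lia].
rewrite (_ : (_.+1 - u.+1 = m)%N); last by lia.
set D' := wdrop _ _ k.+1; set D := wdrop _ _ k; set G := weight _ _ _.
have D0 : 0 <= D := wdrop_ge0 _ _ _; have D'0 : 0 <= D' := wdrop_ge0 _ _ _.
rewrite natrD -[k.+1%:R]natr1.
have a1 : (1 : R) <= w.+1%:R by rewrite ler1n.
have k1 : (1 : R) <= k%:R by rewrite ler1n.
have u1 : (1 : R) <= u%:R by rewrite ler1n.
move: (w.+1%:R : R) (k%:R : R) (u%:R : R) a1 k1 u1 => a l v a1 l1 v1 DD' T.
have d1 : 0 < a + (l + 1) * v by nra.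
have d2 : 0 < (l + 1) * (a + v) by nra.
have DE : D' = D * (l * a) / ((l + 1) * (a + v)) by rewrite -DD' mulfK // gt_eqF.
have DB : D - D' = D * (a + (l + 1) * v) / ((l + 1) * (a + v)).
  rewrite DE; field; rewrite !gt_eqF //; nra.
have Dpos : 0 <= D - D' by rewrite DB divr_ge0 ?(mulr_ge0 D0) ?ltW.
(* Multiplied by [D - D'], the left side becomes exactly [D * D']. *)
have T' : D' * (1 + l * a / (a + (l + 1) * v)) <= c + (G + D').
  by move: T hc; rewrite mulrDr mulr1; lra.
apply: le_trans (ler_wpM2r Dpos T'); rewrite le_eqVlt; apply/orP; left; apply/eqP.
rewrite DB DE; field; rewrite !gt_eqF //; nra.
Qed.
Lemma wdrop1 n m : (0 < n)%N -> wdrop n m 1 * n%:R = m%:R.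
Proof. by move=> n0; rewrite /wdrop !bin1 mul1r divfK // pnatr_eq0 -lt0n. Qed.

(* The best candidate is never picked by default, whence the [- 1 / n]. *)
Lemma weight_log_convex_first u m (c : R) : (0 < u)%N -> (m <= u.*2 + 3)%N ->
  (u + 2 <= m)%N -> (6 <= m + u)%N -> (m + u)%:R^-1 <= c ->
  (wdrop (m + u) m 1 - (m + u)%:R^-1) * wdrop (m + u) m 2
  <= (c + weight (m + u) u.+1 1) * (wdrop (m + u) m 1 - (m + u)%:R^-1 - wdrop (m + u) m 2).
Proof.
move=> u0 mu um n6 hc.
have D1E := @wdrop1 (m + u) m (ltn_trans (isT : 0 < 5) n6)%N.
have D2E := @wdropS (m + u) (m - 1) 1 isT.
have D3E := @wdropS (m + u) (m - 2) 2 isT.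
have G3 := weight_ge0 (m + u) u.+1 3.
have G2 := weight_ge0 (m + u) u.+1 2.
have D20 := wdrop_ge0 (m + u) m 2.
have S2 := @weight_log_convex_step u m 2 (m + u)%:R^-1 u0 mu.
have n0 : (0 : R) < (m + u)%:R by rewrite ltr0n; lia.
have I1 : (m + u)%:R^-1 * (m + u)%:R = 1 :> R by rewrite mulVf // gt_eqF.
have I0 : (0 : R) < (m + u)%:R^-1 by rewrite invr_gt0.
have e2 : weight (m + u) u.+1 2 = weight (m + u) u.+1 3 + wdrop (m + u) m 3.
  by rewrite weightS ?subSS ?addnK //; lia.
have -> : weight (m + u) u.+1 1 = weight (m + u) u.+1 3 + wdrop (m + u) m 3 + wdrop (m + u) m 2.
  by rewrite -e2 weightS ?subSS ?addnK //; lia.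
have {}S2 := S2 ltac:(lia) (lexx _); rewrite e2 in S2.
rewrite !subnK in D2E D3E; [|lia|lia].
have {}D2E := D2E ltac:(lia); have {}D3E := D3E ltac:(lia).
rewrite !natrB in D2E D3E; [|lia|lia|lia|lia].
rewrite !natrD in D1E D2E D3E; rewrite [X in _ * X]natrD in I1.
have {G2 e2} G2 : 0 <= weight (m + u) u.+1 3 + wdrop (m + u) m 3 by rewrite -e2.
move: (wdrop (m + u) m 1) (wdrop (m + u) m 2) (wdrop (m + u) m 3)
  (weight (m + u) u.+1 3) ((m + u)%:R^-1 : R) hc D1E D2E D3E G3 G2 S2 I0 I1 D20.
move=> D1 D2 D3 G I hc D1E D2E D3E G0 G2 S2 I0 I1 D20.
have u1 : (1 : R) <= u%:R by rewrite ler1n.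
have m3 : (3 : R) <= m%:R by rewrite ler_nat; lia.
(* [D1 - I] and [D2] are proportional. Dividing the goal by [D1 - I] and moving the [D2] contained
   in the weight at 1 to the left leaves this inequality. *)
have key : D2 * m%:R <= (c + (G + D3)) * (m%:R + 2 * u%:R - 2).
  apply: (@le_trans _ _ ((I + (G + D3)) * (m%:R + 2 * u%:R - 2))); last first.
    by apply: ler_wpM2r; lra.
  (* From m = 8 on, log-convexity at 2 suffices: the last comparison has difference M (M - 6) + U (M
     - 8) + 8, up to a factor [D2]. Below, eleven pairs remain. *)
  have [m7|m8] := leqP m 7.
    apply: (@le_trans _ _ ((I + D3) * (m%:R + 2 * u%:R - 2))); last first.
      by apply: ler_wpM2r; lra.
    have cases : (u = 1 /\ m = 5)%N \/
      (u = 2 /\ m = 4)%N \/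
      (u = 2 /\ m = 5)%N \/
      (u = 2 /\ m = 6)%N \/
      (u = 2 /\ m = 7)%N \/
      (u = 3 /\ m = 5)%N \/
      (u = 3 /\ m = 6)%N \/
      (u = 3 /\ m = 7)%N \/
      (u = 4 /\ m = 6)%N \/
      (u = 4 /\ m = 7)%N \/
      (u = 5 /\ m = 7)%N by lia.
    case: cases => [[uE mE]|[[uE mE]|[[uE mE]|[[uE mE]|[[uE mE]|[[uE mE]|[[uE mE]|[[uE mE]|[[uE mE]|[[uE mE]|[uE mE]]]]]]]]]]]; rewrite uE mE in D1E D2E D3E I1 *; lra.
  have m8R : (8 : R) <= m%:R by rewrite ler_nat.
  move: (m%:R : R) (u%:R : R) m3 u1 m8R D1E D2E D3E I1 => M U m3 u1 m8R D1E D2E D3E I1.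
  have S2' : D2 * (2 * (M - 2)) <= (I + (G + D3)) * (M + 3 * U - 2).
    have D2pos : 0 < D2.
      have D1pos : 0 < D1 by rewrite -(pmulr_lgt0 _ (_ : 0 < M + U)) ?D1E; lra.
      by rewrite -(pmulr_lgt0 _ (_ : 0 < 2 * (M + U - 1))) ?D2E ?mulr_gt0; lra.
    have e3 : 0 < 3 * (M + U - 2) by lra.
    rewrite -(ler_pM2l D2pos) mulrCA [leRHS]mulrCA.
    have := ler_wpM2r (ltW e3) S2.
    rewrite -[in leLHS]mulrA -[in leRHS]mulrA mulrBl D3E => S3.
    apply: le_trans (le_trans _ S3) _; rewrite le_eqVlt; apply/orP; left; apply/eqP; ring.
  have e : 0 < M + 3 * U - 2 by lra.
  rewrite -(ler_pM2r e); apply: (@le_trans _ _ (D2 * (2 * (M - 2)) * (M + 2 * U - 2))).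
    by rewrite -!mulrA; apply: ler_wpM2l => //; nra.
  by rewrite [leRHS]mulrAC; apply: ler_wpM2r => //; lra.
move: (m%:R : R) (u%:R : R) m3 u1 D1E D2E D3E I1 key => M U m3 u1 D1E D2E D3E I1 key.
have DI : D1 = M * I.
  by apply: (@mulIf _ (M + U)); [rewrite gt_eqF //; lra | rewrite D1E -mulrA I1 mulr1].
have EE : D1 - I = (M - 1) * I by rewrite DI; ring.
have E0 : 0 <= D1 - I by rewrite EE mulr_ge0 //; lra.
have D2M : D2 * (2 * (M + U - 1)) = (D1 - I) * M by rewrite D2E DI; ring.
have K0 : 0 < 2 * (M + U - 1) by lra.
rewrite -(ler_pM2r K0) -mulrA -[leRHS]mulrA [X in _ <= _ * X]mulrBl D2M.
rewrite -mulrBr [leRHS]mulrCA; apply: ler_wpM2l => //; lra.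
Qed.

(* With [c = 1 / n + (1 - p) / (p T)] these are the selection probabilities
   divided by [p T / (n + 1)], where [T] candidates are rejected outright. *)
Definition lweight (c : R) n T k : R := c + weight n T k - (k == 0)%:R / n%:R.

Section LWeight.
Variables (c : R) (n u : nat).
Hypotheses (u0 : (0 < u)%N) (n6 : (6 <= n)%N) (nu : (n <= u * 3 + 3)%N)
  (un : (u * 2 + 2 <= n)%N) (hc : n%:R^-1 <= c).
Let Q k := lweight c n u.+1 k.

(** Only the first drop is reduced, by 1 / n, and it is (n - u) / n before that. *)
Lemma lweight_decr k : (k < n)%N -> Q k.+1 <= Q k.
Proof.
have n0 : (0 : R) < n%:R by rewrite ltr0n; lia.
move=> kn; rewrite /Q /lweight (@weightS _ _ k) ?kn ?subSS //; last by lia.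
case: k kn => [|k] kn /=; last by rewrite !mul0r !subr0 lerD2l lerDl wdrop_ge0.
have : n%:R^-1 <= wdrop n (n - u) 1.
  rewrite -(ler_pM2r n0) mulVf ?gt_eqF // wdrop1; last by lia.
  by rewrite ler1n; lia.
rewrite mul1r mul0r; lra.
Qed.

Lemma lweight_gt0 k : (k <= n)%N -> 0 < Q k.
Proof.
have n0 : (0 : R) < n%:R by rewrite ltr0n; lia.
have Qn : 0 < Q n.
  rewrite /Q /lweight gtn_eqF ?mul0r ?subr0; last by lia.
  have := weight_ge0 n u.+1 n; have : (0 : R) < n%:R^-1 by rewrite invr_gt0.
  by move: hc; lra.
move=> kn; rewrite -(subKn kn); elim: (n - k)%N => [|d IH]; first by rewrite subn0.
have [dn|nd] := ltnP d n; last by rewrite (_ : (n - d.+1 = n - d)%N) //; lia.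
apply: lt_le_trans IH _; have -> : (n - d = (n - d.+1).+1)%N by lia.
by apply: lweight_decr; lia.
Qed.

Lemma lweight_log_convex k : (0 < k < n)%N -> Q k ^+ 2 <= Q k.-1 * Q k.+1.
Proof.
case/andP=> k0 kn; have nE : n = (n - u + u)%N by lia.
case: k k0 kn => // k _ kn /=.
have QS : Q k.+1 = Q k.+2 + wdrop n (n - u) k.+2.
  by rewrite /Q /lweight (@weightS _ _ k.+1) ?subSS //=; [ring|lia].
case: k kn QS => [|k] kn QS.
  have Q0 : Q 0 = Q 1 + (wdrop n (n - u) 1 - n%:R^-1).
    rewrite /Q /lweight (@weightS _ _ 0) ?subSS //=; [ring|lia|lia].
  have := @weight_log_convex_first u (n - u) c u0.
  rewrite -nE => /(_ ltac:(lia) ltac:(lia) n6 hc).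
  have -> : c + weight n u.+1 1 = Q 1 by rewrite /Q /lweight /=; ring.
  move: (Q 0) (Q 1) (Q 2) QS Q0 => q0 q1 q2 -> -> ; nra.
have QS' : Q k.+1 = Q k.+2 + wdrop n (n - u) k.+2.
  rewrite /Q /lweight (@weightS _ _ k.+1) ?subSS //=; [ring|lia|lia].
have := @weight_log_convex_step u (n - u) k.+2 c u0.
rewrite -nE => /(_ ltac:(lia) ltac:(lia) hc).
have -> : c + weight n u.+1 k.+2 = Q k.+2 by rewrite /Q /lweight /=; ring.
by move: (Q k.+1) (Q k.+2) (Q k.+3) QS QS' => q0 q1 q2 -> -> ; nra.
Qed.
End LWeight.

(** Log-convexity makes Q (k + 1) / Q k nondecreasing, so Q (i + l) / Q i is smallest at i = 0. *)
Lemma log_convex_ratio (Q : nat -> R) n : (forall k, (k <= n)%N -> 0 < Q k) ->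
  (forall k, (0 < k < n)%N -> Q k ^+ 2 <= Q k.-1 * Q k.+1) ->
  forall l i, (i + l <= n)%N -> Q i * Q l <= Q 0 * Q (i + l)%N.
Proof.
move=> Qp Qc.
have step a d : (a + d < n)%N -> Q a.+1 * Q (a + d)%N <= Q a * Q (a + d).+1.
  elim: d => [|d IH] ad; first by rewrite addn0 mulrC.
  rewrite addnS in ad *.
  have IH' := IH (ltnW ad); have cv := Qc (a + d).+1 ad; rewrite /= in cv.
  have p0 := Qp (a + d)%N ltac:(lia); have p1 := Qp (a + d).+1 ltac:(lia).
  have p2 := Qp (a + d).+2 ltac:(lia); have p3 := Qp a ltac:(lia).
  rewrite -(ler_pM2r p0).
  apply: (@le_trans _ _ (Q a * Q (a + d).+1 ^+ 2)).
    by rewrite mulrAC expr2 mulrA ler_wpM2r // ltW.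
  by rewrite -mulrA ler_wpM2l // ?(ltW p3) // mulrC.
move=> l; elim=> [|i IH] il; first by rewrite add0n.
have p0 := Qp i ltac:(lia); have p1 := Qp (i + l)%N ltac:(lia).
have p2 := Qp i.+1 ltac:(lia).
have IH' := IH ltac:(lia); have st := step i l ltac:(lia).
rewrite -(ler_pM2l p0) addSn.
apply: (@le_trans _ _ (Q i.+1 * (Q 0 * Q (i + l)%N))).
  by rewrite mulrCA ler_wpM2l // ltW.
rewrite mulrCA [leRHS]mulrCA ler_wpM2l //.
by apply: ltW; apply: Qp; lia.
Qed.
End SelectionWeights.

(** * The threshold *)

Section HarmonicSums.
Set Implicit Arguments.
Unset Strict Implicit.
Variable F : realFieldType.

(** At t = 2 the sum is 1/2 + 1/3 + 1/4. Raising [t] by one loses 1 / t and gains the reciprocals of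
    3 t - 1, 3 t and 3 t + 1, whose sum is at least 1 / t by convexity. *)
Lemma harmonic_tail_gt1 (t : nat) : (2 <= t)%N ->
  1 < \sum_(t <= s < t * 3 - 1) (s%:R : F)^-1.
Proof.
elim: t => // t IH; rewrite ltnS leq_eqVlt => /orP[/eqP <-|t1].
  by rewrite (_ : (2 * 3 - 1 = 5)%N) // 3?big_ltn // big_geq //; lra.
have {}IH := IH t1; apply: lt_le_trans IH _.
have -> : (t.+1 * 3 - 1 = (t * 3 - 1).+3)%N by lia.
rewrite big_ltn; last by lia.
rewrite 3?big_nat_recr /=; [|lia..].
have t0 : (2 : F) <= t%:R by rewrite ler_nat.
set S := (X in _ + X <= _); rewrite -!addrA (addrC _ S) lerD2l.
have -> : ((t * 3 - 1)%:R : F) = t%:R * 3 - 1 by rewrite natrB ?natrM //; lia.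
have -> : ((t * 3 - 1).+1%:R : F) = t%:R * 3 by rewrite -natr1 natrB ?natrM ?subrK //; lia.
have -> : ((t * 3 - 1).+2%:R : F) = t%:R * 3 + 1.
  by rewrite -natr1 -natr1 natrB ?natrM ?subrK //; lia.
move: (t%:R : F) t0 => x x2; rewrite -subr_ge0.
have -> : (x * 3 - 1)^-1 + ((x * 3)^-1 + (x * 3 + 1)^-1) - x^-1
   = 2 / ((x * 3) * (x * 3 - 1) * (x * 3 + 1)).
  by field; rewrite !gt_eqF //; lra.
by rewrite divr_ge0 ?mulr_ge0 //; lra.
Qed.

Lemma harmonic_sum_gt1 (t N : nat) : (0 < t)%N -> (3 <= N)%N -> (t * 3 - 2 < N)%N ->
  1 < \sum_(t <= s < N) (s%:R : F)^-1.
Proof.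
move=> t0 N3 tN; have [t1|t2] : t = 1%N \/ (2 <= t)%N by lia.
  rewrite t1 big_ltn ?(ltnW N3) // big_ltn // invr1.
  by rewrite ltrDl ltr_pwDl ?invr_gt0 ?ltr0n ?sumr_ge0.
apply: lt_le_trans (harmonic_tail_gt1 t2) _.
rewrite [leRHS](big_cat_nat _ (n := (t * 3 - 1)%N)) /=; [|lia|lia].
by rewrite lerDl sumr_ge0.
Qed.

Lemma harmonic_sum_le1 (t N : nat) : (0 < t)%N -> (N <= t * 2)%N ->
  \sum_(t <= s < N) (s%:R : F)^-1 <= 1.
Proof.
move=> t0 Nt; have tR : (0 : F) < t%:R by rewrite ltr0n.
apply: (@le_trans _ _ (\sum_(t <= s < N) (t%:R : F)^-1)).
  apply: ler_sum_nat => s /andP[ts _].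
  by rewrite lef_pV2 ?posrE ?ltr0n ?ler_nat // (leq_trans t0).
by rewrite sumr_const_nat -[leLHS]mulr_natl ler_pdivrMr // mul1r ler_nat; lia.
Qed.
End HarmonicSums.

Section Threshold.
Set Implicit Arguments.
Unset Strict Implicit.

Lemma thresholdP (N : nat) : small_tail N (threshold N).
Proof. by rewrite /threshold; case: ex_minnP. Qed.

Lemma threshold_min (N t : nat) : small_tail N t -> (threshold N <= t)%N.
Proof. by rewrite /threshold; case: ex_minnP => m _; apply. Qed.

Lemma threshold_lb (N : nat) : (3 <= N)%N -> (N <= threshold N * 3 - 2)%N.
Proof.
move=> N3; have /andP[t0 tl] := thresholdP N; rewrite leqNgt; apply/negP => tN.
by have := lt_le_trans (harmonic_sum_gt1 rat t0 N3 tN) tl; rewrite ltxx.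
Qed.

Lemma threshold_pred_sum (N : nat) : (1 < threshold N)%N ->
  1 < \sum_((threshold N).-1 <= s < N) (s%:R : rat)^-1.
Proof.
move=> t1; rewrite ltNge; apply/negP => sm.
have : small_tail N (threshold N).-1.
  by apply/andP; split; [rewrite -ltnS prednK // ltnW|exact: sm].
by move/threshold_min; rewrite leqNgt prednK ?leqnn // ltnW.
Qed.

Lemma threshold_ub (N : nat) : (1 < threshold N)%N -> ((threshold N).-1 * 2 < N)%N.
Proof.
move=> t1; rewrite ltnNge; apply/negP => NT.
have T0 : (0 < (threshold N).-1)%N by rewrite -ltnS prednK // ltnW.
by have := lt_le_trans (threshold_pred_sum t1) (harmonic_sum_le1 rat T0 NT); rewrite ltxx.
Qed.

(** The threshold is defined by a rational sum, while the comparison with [ln] takes place in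
    [R]. *)
Lemma harmonic_sum_rat (R : realType) (a b : nat) :
  ratr (\sum_(a <= s < b) (s%:R : rat)^-1) = \sum_(a <= s < b) (s%:R : R)^-1.
Proof.
by rewrite rmorph_sum; apply: eq_bigr => s _; rewrite fmorphV rmorph_nat.
Qed.
End Threshold.

(** * Selection probabilities *)

Section StopCharacterization.
Set Implicit Arguments.
Unset Strict Implicit.
Local Open Scope nat_scope.
Variable n : nat.
Implicit Types (pi tau sigma : 'S_n.+1) (i j k : 'I_n.+1).

(** Times start at 0, so stopping at time [k] requires [T <= k], and exactly [T] candidates are
    rejected outright. *)
Let T := (threshold n.+1).-1.

Definition record pi k : bool := [forall (j : 'I_n.+1 | j <= k), pi k <= pi j].

Lemma recordP pi k : reflect (forall j, j <= k -> pi k <= pi j) (record pi k).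
Proof.
by apply: (iffP forallP) => H j; [move=> jk; move: (H j); rewrite jk|apply/implyP/H].
Qed.

Definition rank_stop pi : 'I_n.+1 := secretary_stop 1%g pi.

(** By adaptedness only relative ranks matter, so candidates may be renamed by their ranks. *)
Lemma secretary_stop_rank sigma tau :
  secretary_stop sigma tau = rank_stop (tau * sigma^-1)%g.
Proof.
apply/eqP; rewrite eq_sym /rank_stop -(@secretary_adapted n sigma tau) // => i j _ _.
by rewrite /better invg1 !perm1 !permM.
Qed.

Lemma head_filter (X : eqType) (x0 : X) (P : pred X) (s : seq X) :
  head x0 (seq.filter P s) = nth x0 s (find P s).
Proof. by elim: s => //= x s IH; case: (P x). Qed.

Lemma rank_stop_spec pi :
  ((T <= rank_stop pi) && record pi (rank_stop pi) || (rank_stop pi == ord_max)) /\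
  (forall i, i < rank_stop pi -> ~~ ((T <= i) && record pi i)).
Proof.
rewrite /rank_stop /secretary_stop head_filter; set P := (P in find P _).
have PE i : P i = (T <= i) && record pi i.
  rewrite /P /T; congr (_ && _); first by lia.
  apply/forallP/recordP => H j.
    by move=> ji; move: (H j); rewrite ji /better invg1 !perm1 -leqNgt.
  by apply/implyP => ji; rewrite /better invg1 !perm1 -leqNgt; apply: H.
set f := find P _; have fs : f <= n.+1 by rewrite -[n.+1]size_enum_ord find_size.
split.
  have [hs|] := boolP (has P (enum 'I_n.+1)); first by rewrite -PE (nth_find _ hs).
  move=> nhs; apply/orP; right; rewrite nth_default //.
  by rewrite leqNgt -has_find.
move=> i; rewrite -PE => lt.
have {}lt : i < f.
  move: fs; rewrite leq_eqVlt => /orP[/eqP ->|fn]; first exact: ltn_ord.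
  by move: lt; rewrite nth_enum_ord.
by have := before_find ord_max lt; rewrite nth_ord_enum => ->.
Qed.

(** For [T <= j], the algorithm is still running at time [j] exactly when the best of the earlier
    arrivals is among the rejected ones: from [T] on, that arrival would have been a record. *)
Definition settled (j : 'I_n.+1) pi : bool :=
  [exists i : 'I_n.+1, (i < T) && prefix_min j i pi].

Hypothesis Tn : 0 < T <= n.

Lemma settledP j pi : T <= j ->
  reflect (forall i, i < j -> ~~ ((T <= i) && record pi i)) (settled j pi).
Proof.
move=> Tj; apply: (iffP existsP) => [[i /andP[iT /prefix_minP im]] a aj|H].
  apply/negP => /andP[Ta /recordP ra].
  have := ra i ltac:(lia); have := im a aj => l1 l2.
  have /perm_inj/(congr1 val) /= : pi i = pi a by apply: val_inj; apply/eqP; rewrite eqn_leq l1.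
  by lia.
have j0 : 0 < j by lia.
case: (@arg_minnP _ ord0 (fun i : 'I_n.+1 => i < j) (fun i => val (pi i)) j0) => i ij imin.
exists i; apply/andP; split; last exact/prefix_minP.
rewrite ltnNge; apply/negP => Ti; case/negP: (H i ij); rewrite Ti /=.
by apply/recordP => a ai; apply: imin; lia.
Qed.

Lemma rank_stopE pi j :
  (rank_stop pi == j) = [&& T <= j, settled j pi & record pi j || (j == ord_max)].
Proof.
have [s1 s2] := rank_stop_spec pi; case/andP: Tn => T0 Tn'.
apply/eqP/and3P => [<-|[Tj /(settledP _ Tj) st rj]].
  have Ts : T <= rank_stop pi by case/orP: s1 => [/andP[]//|/eqP ->].
  by split=> //; [apply/settledP|move: s1; rewrite Ts].
apply: ord_inj; apply/eqP; rewrite eqn_leq.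
apply/andP; split; rewrite leqNgt; apply/negP => lt.
  case/orP: rj => [rj|/eqP jm]; first by move: (s2 j lt); rewrite Tj rj.
  by move: lt; rewrite jm ltnNge -ltnS ltn_ord.
case/orP: s1 => [s1|/eqP jm]; first by move: (st _ lt); rewrite s1.
by move: lt; rewrite jm ltnNge -ltnS ltn_ord.
Qed.

Lemma record_above pi j k : (pi j == k) && record pi j = (pi j == k) && above j k pi.
Proof.
case: eqP => //= <-; apply/recordP/aboveP => H i.
  move=> ij; rewrite ltn_neqAle H ?(ltnW ij) // andbT; apply/negP => /eqP/val_inj/perm_inj e.
  by rewrite e ltnn in ij.
by rewrite leq_eqVlt => /orP[/eqP/val_inj -> //|/H/ltnW].
Qed.

(** The last candidate is taken by default exactly when it is not the best and rank 0 arrives before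
    [T]; [nperm_two] counts each of the [T] possible times. *)
Lemma nperm_default k :
  n * nperm (fun pi => [&& pi ord_max == k, settled ord_max pi & ~~ record pi ord_max])
  = (k != ord0) * (T * n`!).
Proof.
case/andP: Tn => T0 Tn'; have n0 : 0 < n by lia.
have [->|k0] /= := eqVneq k ord0.
  rewrite mul0n /nperm big1 ?muln0 // => pi _; apply/eqP; rewrite eqb0.
  apply/negP => /and3P[/eqP p0 _ /negP]; apply; apply/recordP => j _.
  by rewrite p0.
have PE pi : [&& pi ord_max == k, settled ord_max pi & ~~ record pi ord_max]
    = \sum_(i : 'I_n.+1 | i < T) ((pi ord_max == k) && (pi i == ord0)) :> nat.
  case: eqP => [pk|_] /=; last by rewrite big1.
  have pj : pi ((pi^-1)%g ord0) = ord0 by rewrite permKV.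
  set i0 := (pi^-1)%g ord0 in pj.
  have i0n : i0 < n.
    rewrite ltn_neqAle -ltnS ltn_ord andbT; apply: contra k0 => /eqP e.
    by rewrite -pk -pj; apply/eqP; congr (pi _); apply: val_inj.
  have -> : settled ord_max pi && ~~ record pi ord_max = (i0 < T).
    apply/idP/idP => [/andP[/existsP[i /andP[iT /prefix_minP im]] _]|iT].
      have := im i0 i0n; rewrite pj leqn0 => /eqP e.
      by rewrite (_ : i0 = i) //; apply: (@perm_inj _ pi); rewrite pj; apply: val_inj.
    apply/andP; split.
      by apply/existsP; exists i0; rewrite iT; apply/prefix_minP => a _; rewrite pj.
    apply/negP => /recordP /(_ i0 (ltnW i0n)); rewrite pj pk leqn0 => /eqP e.
    by case/eqP: k0; apply: val_inj.
  case: ltnP => [iT|Ti].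
    rewrite (bigD1 i0) //= pj eqxx big1 // => a /andP[_ ne].
    by apply/eqP; rewrite eqb0 -pj (inj_eq (@perm_inj _ pi)).
  rewrite big1 // => a aT; apply/eqP; rewrite eqb0 -pj (inj_eq (@perm_inj _ pi)).
  by apply/negP => /eqP e; rewrite e ltnNge Ti in aT.
rewrite /nperm (eq_bigr _ (fun pi _ => PE pi)) -(exchange_nperm (fun i : 'I_n.+1 => i < T) (fun i pi => (pi ord_max == k) && (pi i == ord0))).
rewrite big_distrr /= (eq_bigr (fun=> n`!)) => [|i iT]; last first.
  apply: nperm_two => //; rewrite -val_eqE /=; lia.
rewrite mul1n sum_nat_const; congr (_ * _); rewrite -sum1_card big_mkcond /=.
rewrite -[RHS]subn0 -(@sum_ord_itv n 0 T) ?(leq_trans Tn') //.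
Qed.

(** Split by the stopping time. A stop at the last time is either on a record, which belongs to the
    sum, or by default, which is the extra term. *)
Lemma nperm_rank_stop k :
  nperm (fun pi => pi (rank_stop pi) == k)
  = \sum_(j : 'I_n.+1 | T <= j)
      nperm (fun pi => [&& pi j == k, above j k pi & settled j pi])
  + nperm (fun pi => [&& pi ord_max == k, settled ord_max pi & ~~ record pi ord_max]).
Proof.
case/andP: Tn => T0 Tn'.
transitivity (\sum_(j : 'I_n.+1) nperm (fun pi => (pi j == k) && (rank_stop pi == j))).
  rewrite (exchange_nperm predT (fun j pi => (pi j == k) && (rank_stop pi == j))).
  apply: eq_bigr => pi _; rewrite (bigD1 (rank_stop pi)) //= eqxx andbT big1 ?addn0 //.
  by move=> j; rewrite eq_sym => /negPf ->; rewrite andbF.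
rewrite [in RHS]big_mkcond /= (bigD1 ord_max) //= [in RHS](bigD1 ord_max) //= Tn' addnAC.
congr (_ + _).
  rewrite /nperm -big_split /=; apply: eq_bigr => pi _.
  rewrite rank_stopE Tn' eqxx orbT andbT /=; have := record_above pi ord_max k.
  by case: (pi _ == k) => //= <-; case: (record _ _); case: (settled _ _).
apply: eq_bigr => j jm; case: (leqP T j) => Tj; last first.
  by rewrite /nperm big1 // => pi _; rewrite rank_stopE leqNgt Tj andbF.
apply: eq_nperm => pi; rewrite rank_stopE Tj (negPf jm) orbF /=; have := record_above pi j k.
by case: (pi _ == k) => //= <-; case: (record _ _); case: (settled _ _).
Qed.
End StopCharacterization.

Section SelectionProbabilities.
Set Implicit Arguments.
Unset Strict Implicit.
Variable R : realType.

Lemma nperm_selected n (k : 'I_n.+1) : let T := (threshold n.+1).-1 in (0 < T <= n)%N ->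
  (nperm (fun pi => pi (rank_stop pi) == k))%:R / (n.+1)`!%:R
  = T%:R / n.+1%:R * lweight (n%:R^-1 : R) n T k.
Proof.
move=> T Tn; have /andP[T0 Tn'] := Tn.
have n0 : (n%:R : R) != 0 by rewrite pnatr_eq0 -lt0n (leq_trans T0).
have f0 : (n`!%:R : R) != 0 by rewrite pnatr_eq0 -lt0n fact_gt0.
have N0 : (n.+1%:R : R) != 0 by rewrite pnatr_eq0.
rewrite (nperm_rank_stop Tn) natrD natr_sum.
have -> : \sum_(j : 'I_n.+1 | (T <= j)%N)
     (nperm (fun pi => [&& pi j == k, above j k pi & settled j pi]))%:R
   = n`!%:R * T%:R * weight R n T k.
  rewrite /weight big_geq_mkord mulr_sumr; apply: eq_bigr => j Tj.
  have j0 : (j%:R : R) != 0 by rewrite pnatr_eq0 -lt0n (leq_trans T0).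
  have C0 : ('C(n, j)%:R : R) != 0 by rewrite pnatr_eq0 -lt0n bin_gt0 -ltnS.
  have TTj : (0 < T <= j)%N by rewrite T0.
  have := congr1 (fun m => m%:R : R) (nperm_early_min k TTj).
  have := congr1 (fun m => m%:R : R) (nperm_above j k).
  rewrite !natrM => e1 e2.
  apply: (mulfI j0); apply: (mulIf C0); rewrite e2 -[LHS]mulrA e1.
  by field; rewrite ?C0 ?j0.
have -> : (nperm (fun pi => [&& pi ord_max == k, settled ord_max pi
    & ~~ record pi ord_max]))%:R = n`!%:R * T%:R * (n%:R^-1 - (val k == 0%N)%:R / n%:R) :> R.
  have := congr1 (fun m => m%:R : R) (nperm_default Tn k).
  rewrite !natrM => e; apply: (mulfI n0); rewrite e -val_eqE /=.
  by case: (_ == _) => /=; field.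
rewrite /lweight factS natrM; field; by rewrite nat1r N0 f0 n0.
Qed.

Lemma card_choice n (sigma : 'S_n.+1) (k : 'I_n.+1) :
  #|[set tau : 'S_n.+1 | Defs.choice (secretary n) sigma tau == sigma k]%SET|
  = nperm (fun pi => pi (rank_stop pi) == k).
Proof.
rewrite -sum1dep_card big_mkcond /= (reindex_inj (mulIg sigma)) /=.
apply: eq_bigr => pi _; rewrite /Defs.choice /= secretary_stop_rank mulgK permM.
by rewrite (inj_eq (@perm_inj _ sigma)); case: eqP.
Qed.

Lemma card_blind n (sigma : 'S_n.+1) (k : 'I_n.+1) :
  #|[set tau : 'S_n.+1 | Defs.choice (blind n) sigma tau == k]%SET| = n`!.
Proof.
rewrite -sum1dep_card big_mkcond /= -(nperm_fix ord0 k).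
by apply: eq_bigr => pi _; rewrite /Defs.choice /=; case: eqP.
Qed.

Lemma prob_choice_sum n (M : rand_alg R n) (sigma : 'S_n.+1) (S : {set 'I_n.+1}) :
  prob_choice M sigma S = \sum_(c in S) prob_choice M sigma [set c]%SET.
Proof.
rewrite /prob_choice exchange_big /=; apply: eq_bigr => w _.
rewrite -mulr_sumr -mulr_suml -natr_sum; congr (_ * (_%:R / _)).
rewrite -sum1dep_card (partition_big (Defs.choice (play w) sigma) (fun c => c \in S)) //=.
apply: eq_bigr => c cS; rewrite sum1dep_card; apply: eq_card => tau.
by rewrite !inE; case: eqP => [->|]; rewrite ?cS ?andbF.
Qed.

Definition mix_weight (p : R) n (k : nat) : R :=
  let T := (threshold n.+1).-1 in
  p * T%:R / n.+1%:R * lweight (n%:R^-1 + (1 - p) / (p * T%:R)) n T k.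

Lemma prob_choice_mix (p : R) (hp : 0 <= p <= 1) n (sigma : 'S_n.+1) (k : 'I_n.+1) :
  0 < p -> (0 < (threshold n.+1).-1 <= n)%N ->
  prob_choice (p_mix hp (secretary n) (blind n)) sigma [set sigma k]%SET = mix_weight p n k.
Proof.
move=> p0 Tn; have /andP[T0 Tn'] := Tn.
rewrite /prob_choice /= big_bool /bernoulli_pmf /=.
under eq_finset => tau do rewrite inE.
rewrite card_choice nperm_selected //.
under eq_finset => tau do rewrite inE.
rewrite card_blind /mix_weight /lweight factS natrM.
have f0 : (n`!%:R : R) != 0 by rewrite pnatr_eq0 -lt0n fact_gt0.
have N0 : (n.+1%:R : R) != 0 by rewrite pnatr_eq0.
have n0 : (n%:R : R) != 0 by rewrite pnatr_eq0 -lt0n (leq_trans T0).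
have TT0 : ((threshold n.+1).-1%:R : R) != 0 by rewrite pnatr_eq0 -lt0n.
by field; rewrite n0 TT0 (gt_eqF p0) nat1r N0 f0.
Qed.

Lemma sel_prob_mix (p : R) (hp : 0 <= p <= 1) n (sigma : 'S_n.+1) (k : nat) :
  0 < p -> (0 < (threshold n.+1).-1 <= n)%N -> (k <= n)%N ->
  sel_prob (p_mix hp (secretary n) (blind n)) sigma k.+1 = mix_weight p n k.
Proof. by move=> p0 Tn kn; rewrite /sel_prob prob_choice_mix //= inordK. Qed.
End SelectionProbabilities.

(** * Privacy *)

Section Neighbours.
Set Implicit Arguments.
Unset Strict Implicit.

Lemma swap_dist_le1 l n (sigma rho : 'S_n.+1) : (0 < l)%N ->
  (swap_dist l sigma rho <= 1)%N -> sigma = rho \/ swap_step l rho sigma.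
Proof.
move=> l0 d1; have [+ _] := swap_distP sigma rho l0.
move: d1; case: (swap_dist l sigma rho) => [|[|]] // _ /existsP[s /andP[ps /eqP ls]].
  by left; rewrite -ls (tuple0 s).
by right; case: s ps ls => [[|x [|]]] //= _; rewrite andbT => ? <-.
Qed.

Lemma swap_step_dist_le1 l n (sigma rho : 'S_n.+1) : (0 < l)%N ->
  swap_step l rho sigma -> (swap_dist l sigma rho <= 1)%N.
Proof.
move=> l0 st; have [_ ->] := swap_distP sigma rho l0 => //.
by apply/existsP; exists [tuple sigma]; rewrite /= st /=.
Qed.
End Neighbours.

Section Privacy.
Set Implicit Arguments.
Unset Strict Implicit.
Variable R : realType.

(** Here [u] is the threshold minus 2. It is positive because [threshold_lb] makes the threshold at
    least 3 from seven candidates on. *)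
Lemma threshold_range n : (7 <= n.+1)%N -> exists u : nat,
  [/\ (threshold n.+1).-1 = u.+1, (0 < u)%N, (n <= u * 3 + 3)%N & (u * 2 + 2 <= n)%N].
Proof.
move=> n7; have lb := @threshold_lb n.+1 (leq_trans (isT : 3 <= 7)%N n7).
have t1 : (1 < threshold n.+1)%N by lia.
have ub := threshold_ub t1.
by exists (threshold n.+1).-2; split; lia.
Qed.

Section Weights.
Variables (p : R) (n : nat).
Hypotheses (p01 : 0 < p <= 1) (n7 : (7 <= n.+1)%N).
Let q := mix_weight p n.

Lemma mix_weightE : exists A c u, [/\ 0 < A, forall k, q k = A * lweight (c : R) n u.+1 k,
  (0 < u)%N /\ (n <= u * 3 + 3)%N, (u * 2 + 2 <= n)%N & n%:R^-1 <= c].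
Proof.
have /andP[p0 p1] := p01; have [u [Tu u0 nu un]] := threshold_range n7.
exists (p * u.+1%:R / n.+1%:R), (n%:R^-1 + (1 - p) / (p * u.+1%:R)), u.
split=> //; first by rewrite divr_gt0 ?mulr_gt0 ?ltr0n.
  by move=> k; rewrite /q /mix_weight Tu.
by rewrite lerDl divr_ge0 ?subr_ge0 // mulr_ge0 ?ler0n // ltW.
Qed.

Lemma mix_weight_gt0 k : (k <= n)%N -> 0 < q k.
Proof.
have [A [c [u [A0 qE [u0 nu] un hc]]]] := mix_weightE.
by move=> kn; rewrite qE mulr_gt0 // lweight_gt0.
Qed.

Lemma mix_weight_decr i j : (i <= j <= n)%N -> q j <= q i.
Proof.
have [A [c [u [A0 qE [u0 nu] un hc]]]] := mix_weightE.
case/andP=> + jn; elim: j jn => [|j IH] jn; first by rewrite leqn0 => /eqP ->.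
rewrite leq_eqVlt => /orP[/eqP -> //|ij].
apply: le_trans (IH (ltnW jn) ij).
by rewrite !qE ler_pM2l // lweight_decr.
Qed.

Lemma mix_weight_ratio l i j : (l <= n)%N -> (i <= j <= n)%N -> (j <= i + l)%N ->
  q i * q l <= q 0 * q j.
Proof.
have [A [c [u [A0 qE [u0 nu] un hc]]]] := mix_weightE.
have LR a b : (a + b <= n)%N -> q a * q b <= q 0 * q (a + b)%N.
  move=> ab; rewrite !qE mulrACA [leRHS]mulrACA ler_pM2l ?mulr_gt0 //.
  apply: (@log_convex_ratio R (lweight c n u.+1) n) => // k kn.
    exact: lweight_gt0.
  exact: lweight_log_convex.
move=> ln /andP[ij jn] jil; have q0 := mix_weight_gt0 (leq0n n).
have ql := mix_weight_gt0 ln.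
have [iln|iln] := leqP (i + l) n.
  by apply: le_trans (LR _ _ iln) _; rewrite ler_pM2l // mix_weight_decr // jil.
(* Here [i] exceeds [n - l], so monotonicity reduces to the extreme pair [n - l], [n]. *)
apply: (@le_trans _ _ (q (n - l)%N * q l)).
  by rewrite ler_pM2r // mix_weight_decr //; lia.
apply: le_trans (LR _ _ _) _; first by lia.
by rewrite ler_pM2l // mix_weight_decr //; lia.
Qed.
End Weights.

Variables (l n : nat) (p delta : R) (hp : 0 <= p <= 1).
Hypotheses (hl : (1 <= l)%N) (hp0 : 0 < p) (hd : 0 <= delta)
  (n7 : (7 <= n.+1)%N) (ln : (l < n.+1)%N).
Let M := p_mix hp (secretary n) (blind n).
Let q := mix_weight p n.
Let p01 : 0 < p <= 1.
Proof. by rewrite hp0; case/andP: hp. Qed.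

Lemma prob_choice_mix_rank (sigma : 'S_n.+1) c :
  prob_choice M sigma [set c]%SET = q ((sigma^-1)%g c).
Proof.
have [u [Tu u0 nu un]] := threshold_range n7.
rewrite -{1}[c](permKV sigma) prob_choice_mix // Tu; lia.
Qed.

(** A swap raises the selection probability of one candidate only, the one moved from rank [j] up to
    rank [i]; [delta] is spent on it once, and every other candidate satisfies the pure bound. *)
Lemma diff_private_mix eps : 1 <= expR eps -> q 0 <= expR eps * q l + delta ->
  diff_private l eps delta M.
Proof.
set x := expR eps => x1 q0x S sigma rho /(swap_dist_le1 hl) sr.
rewrite !(prob_choice_sum _ _ S).
rewrite (eq_bigr _ (fun c _ => prob_choice_mix_rank sigma c)).
rewrite (eq_bigr _ (fun c _ => prob_choice_mix_rank rho c)).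
have qp c : 0 < q (c : 'I_n.+1) by rewrite mix_weight_gt0 // -ltnS.
have qx c : q (c : 'I_n.+1) <= x * q c by rewrite ler_peMl // ltW.
case: sr => [->|/existsP[i /existsP[j /and3P[ij jil /eqP ->]]]].
  rewrite mulr_sumr ler_wpDr //; apply: ler_sum => c _; exact: qx.
have qij : q j <= q i by apply: mix_weight_decr => //; rewrite ltnW //= -ltnS.
(* Scale the inequality for ranks 0 and [l] by [q i / q 0], which is at most 1, and use that
   [q i * q l / q 0] is at most [q j]. *)
have qi : q i <= x * q j + delta.
  have := @mix_weight_ratio p n p01 n7 l i j ln; rewrite (ltnW ij) -ltnS ltn_ord.
  move=> /(_ isT); have -> : (j <= i + l)%N by lia.
  move=> /(_ isT); rewrite -!/(q _) => ratio.
  have q0 : 0 < q 0 := qp ord0.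
  have qi0 : q i <= q 0 by apply: mix_weight_decr => //; rewrite leq0n -ltnS /=.
  rewrite -(ler_pM2l q0); have qip := qp i; have x0 : 0 <= x by lra.
  apply: (@le_trans _ _ (q i * (x * q l + delta))); first by rewrite mulrC ler_pM2l.
  have := ler_wpM2l x0 ratio; have := ler_wpM2r hd qi0; lra.
set b := rho j; apply: (@le_trans _ _ (\sum_(c in S) (x * q ((rho^-1)%g c) + delta *+ (c == b)))).
  apply: ler_sum => c _; rewrite invMg tpermV permM.
  case: tpermP => [->|->|/eqP ca /eqP cb].
  - rewrite !permK /b (inj_eq (@perm_inj _ rho)) -val_eqE /= (ltn_eqF ij) mulr0n addr0.
    exact: le_trans qij (qx i).
  - by rewrite !permK eqxx mulr1n.
  - by rewrite /b (negPf cb) mulr0n addr0.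
rewrite big_split /= -mulr_sumr lerD2l.
have [bS|bS] := boolP (b \in S).
  rewrite (bigD1 b) //= eqxx mulr1n big1 ?addr0 // => c /andP[_ /negPf ->].
  by rewrite mulr0n.
by rewrite big1 // => c cS; case: eqP => [cb|]; rewrite ?mulr0n // -cb cS in bS *.
Qed.

Lemma diff_private_mix_only_if (sigma : 'S_n.+1) eps :
  diff_private l eps delta M -> q 0 <= expR eps * q l + delta.
Proof.
(* The best candidate of [sigma] has rank [l] in [rho]; the event tested is its selection. *)
pose j : 'I_n.+1 := Ordinal ln; pose rho := (sigma * tperm (sigma ord0) (sigma j))%g.
have r0 : rho ord0 = sigma j by rewrite /rho permM tpermL.
have rj : rho j = sigma ord0 by rewrite /rho permM tpermR.
have st : swap_step l rho sigma.
  apply/existsP; exists ord0; apply/existsP; exists j.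
  rewrite /= subn0 leqnn hl /= r0 rj tpermC /rho -mulgA tperm2 mulg1; exact: eqxx.
move=> /(_ [set sigma ord0]%SET sigma rho (swap_step_dist_le1 hl st)).
by rewrite -{2}rj !prob_choice_mix_rank !permK.
Qed.
End Privacy.

(** * Asymptotics *)

Section Asymptotics.
Set Implicit Arguments.
Unset Strict Implicit.
Variable R : realType.
Implicit Types (f g h : nat -> R) (a b : R).

Lemma cvg_eventually_eq f g a N : (forall n, (N <= n)%N -> f n = g n) ->
  f n @[n --> \oo] --> a -> g n @[n --> \oo] --> a.
Proof.
move=> fg fa; apply: cvg_trans fa; apply: near_eq_cvg.
by near=> n; apply: fg; near: n; exact: nbhs_infty_ge.
Unshelve. all: by end_near. Qed.

Lemma squeeze_eventually f g h a N : (forall n, (N <= n)%N -> f n <= g n <= h n) ->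
  f n @[n --> \oo] --> a -> h n @[n --> \oo] --> a -> g n @[n --> \oo] --> a.
Proof.
move=> fgh; apply: squeeze_cvgr.
by near=> n; apply: fgh; near: n; exact: nbhs_infty_ge.
Unshelve. all: by end_near. Qed.

Lemma cvg_invn : n%:R^-1 @[n --> \oo] --> (0 : R).
Proof. by rewrite -(cvg_shiftS (fun n => n%:R^-1 : R)); exact: cvg_harmonic. Qed.

Lemma ln_natS (b : nat) : (0 < b)%N -> ln (b.+1%:R : R) - ln b%:R <= b%:R^-1.
Proof.
move=> b0; have bR : (0 : R) < b%:R by rewrite ltr0n.
rewrite -ln_div ?posrE ?ltr0n //.
have -> : b.+1%:R / b%:R = 1 + b%:R^-1 :> R.
  by rewrite -natr1 mulrDl divff ?gt_eqF // mul1r.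
by apply: le_ln1Dx; apply: lt_trans (_ : 0 < _); rewrite ?invr_gt0 // oppr_lt0.
Qed.

Lemma ln_natS_ge (b : nat) : (0 < b)%N -> b.+1%:R^-1 <= ln (b.+1%:R : R) - ln b%:R.
Proof.
move=> b0; have bR : (0 : R) < b%:R by rewrite ltr0n.
rewrite -lerN2 opprB -ln_div ?posrE ?ltr0n //.
have bS : (0 : R) < b.+1%:R by rewrite ltr0n.
have e : b%:R / b.+1%:R = 1 + - b.+1%:R^-1 :> R.
  by apply: (mulIf (lt0r_neq0 bS)); rewrite divfK ?gt_eqF // mulrDl mulNr mulVf ?gt_eqF //
     mul1r -natr1 addrK.
rewrite e; apply: le_ln1Dx; rewrite ltrN2 invf_lt1 // ltr1n; exact: b0.
Qed.

Lemma ln_le_harmonic (a b : nat) : (0 < a <= b)%N ->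
  ln (b%:R : R) - ln a%:R <= \sum_(a <= s < b) s%:R^-1.
Proof.
case/andP=> a0; elim: b => [|b IH]; first by rewrite leqNgt a0.
rewrite leq_eqVlt => /orP[/eqP <-|]; first by rewrite subrr big_geq.
rewrite ltnS => ab; rewrite big_nat_recr //=.
have := IH ab; have := ln_natS (leq_trans a0 ab); lra.
Qed.

Lemma harmonic_le_ln (a b : nat) : (0 < a <= b)%N ->
  \sum_(a.+1 <= s < b.+1) (s%:R^-1 : R) <= ln b%:R - ln a%:R.
Proof.
case/andP=> a0; elim: b => [|b IH]; first by rewrite leqNgt a0.
rewrite leq_eqVlt => /orP[/eqP <-|]; first by rewrite subrr big_geq.
rewrite ltnS => ab; rewrite big_nat_recr //=.
have := lerD (IH ab) (ln_natS_ge (leq_trans a0 ab)).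
by rewrite [X in _ <= X -> _]addrC addrA subrK.
Qed.

Definition rejected n : nat := (threshold n.+1).-1.

(** With threshold u + 2, the defining sum being at most 1 gives n + 1 <= e (u + 2), and minimality
    gives e u <= n; so T = u + 1 is within 1 of (n + 1) / e. *)
Lemma rejected_bounds n : (6 <= n)%N ->
  (expR 1 : R)^-1 - n.+1%:R^-1 <= (rejected n)%:R / n.+1%:R <= (expR 1 : R)^-1 + n.+1%:R^-1.
Proof.
move=> n6; have [u [Tu u0 nu un]] := threshold_range (n6 : (7 <= n.+1)%N).
have N0 : (0 : R) < n.+1%:R by rewrite ltr0n.
have e0 : 0 < expR (1 : R) := expR_gt0 1.
have t1 : (1 < threshold n.+1)%N by move: Tu; case: (threshold _) => [|[]].
have tE : threshold n.+1 = u.+2 by rewrite -Tu prednK // ltnW.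
have up : n.+1%:R <= expR 1 * (u.+2%:R : R).
  have /andP[_ tl] := thresholdP n.+1.
  have : (ratr (\sum_(threshold n.+1 <= s < n.+1) (s%:R : rat)^-1) : R) <= ratr 1.
    by rewrite ler_rat.
  rewrite harmonic_sum_rat rmorph1 tE => H.
  have := @ln_le_harmonic u.+2 n.+1; rewrite (_ : (0 < u.+2 <= n.+1)%N); last by lia.
  move=> /(_ isT) H2.
  have : expR (ln (n.+1%:R : R)) <= expR (1 + ln u.+2%:R).
    by rewrite ler_expR -lerBlDr; exact: le_trans H2 H.
  by rewrite expRD !lnK ?posrE ?ltr0n.
have lo : expR 1 * (u%:R : R) <= n%:R.
  have := threshold_pred_sum t1; rewrite Tu -(ltr_rat R) harmonic_sum_rat rmorph1 => H.
  have := @harmonic_le_ln u n; rewrite (_ : (0 < u <= n)%N); last by lia.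
  move=> /(_ isT) H2.
  have : expR (1 + ln (u%:R : R)) <= expR (ln n%:R).
    by rewrite ler_expR -lerBrDr; exact: ltW (lt_le_trans H H2).
  have n0 : (0 < n)%N by lia.
  by rewrite expRD !lnK ?posrE ?ltr0n.
rewrite /rejected Tu; apply/andP; split.
  rewrite lerBlDr -[X in _ + X]mul1r -mulrDl natr1 -[leLHS]div1r.
  by rewrite ler_pdivrMr // mulrAC ler_pdivlMr // mul1r mulrC.
rewrite -lerBlDr -[X in _ - X]mul1r -mulrBl -[u.+1%:R]natr1 addrK.
rewrite ler_pdivrMr // -(ler_pM2l e0) mulrA divff ?gt_eqF // mul1r.
by apply: le_trans lo _; rewrite ler_nat.
Qed.

Lemma cvg_rejected : (rejected n)%:R / n.+1%:R @[n --> \oo] --> (expR 1 : R)^-1.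
Proof.
have iS : n.+1%:R^-1 @[n --> \oo] --> (0 : R) by exact: cvg_harmonic.
apply: (@squeeze_eventually (fun n => (expR 1)^-1 - n.+1%:R^-1) _
  (fun n => (expR 1)^-1 + n.+1%:R^-1) _ 6); first exact: rejected_bounds.
  rewrite -[X in _ --> X]subr0; apply: cvgB => //; exact: cvg_cst.
rewrite -[X in _ --> X]addr0; apply: cvgD => //; exact: cvg_cst.
Qed.

Lemma cvg_inv_rejected : (rejected n)%:R^-1 @[n --> \oo] --> (0 : R).
Proof.
apply: (@squeeze_eventually (fun=> 0) _ (fun n => 3 * n%:R^-1) _ 6).
- move=> n n6; have [u [Tu u0 nu un]] := threshold_range (n6 : (7 <= n.+1)%N).
  have n0 : (0 : R) < n%:R by rewrite ltr0n; lia.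
  rewrite /rejected Tu invr_ge0 ler0n /= -div1r ler_pdivrMr ?ltr0n // mulrAC.
  rewrite ler_pdivlMr // mul1r -natrM ler_nat; lia.
- exact: cvg_cst.
- by rewrite -[X in _ --> X](mulr0 3); apply: cvgM; [exact: cvg_cst|exact: cvg_invn].
Qed.

(** The weight at 0 is the harmonic sum from T to n: it exceeds 1 by minimality of the threshold,
    and without its first term 1 / T it is at most 1. *)
Lemma weight0_bounds n : (6 <= n)%N ->
  1 <= weight R n (rejected n) 0 <= 1 + (rejected n)%:R^-1.
Proof.
move=> n6; have [u [Tu u0 nu un]] := threshold_range (n6 : (7 <= n.+1)%N).
have t1 : (1 < threshold n.+1)%N by move: Tu; case: (threshold _) => [|[]].
have tE : threshold n.+1 = u.+2 by rewrite -Tu prednK // ltnW.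
rewrite weight0 /rejected -!harmonic_sum_rat; apply/andP; split.
  by rewrite -(rmorph1 (@ratr R)) ler_rat ltW // threshold_pred_sum.
have /andP[_ tl] := thresholdP n.+1.
rewrite Tu big_ltn; last by lia.
rewrite rmorphD fmorphV rmorph_nat addrC lerD2r -(rmorph1 (@ratr R)) ler_rat.
by rewrite -tE.
Qed.

Lemma cvg_weight0 : weight R n (rejected n) 0 @[n --> \oo] --> (1 : R).
Proof.
apply: (@squeeze_eventually (fun=> 1) _ (fun n => 1 + (rejected n)%:R^-1) _ 6).
- exact: weight0_bounds.
- exact: cvg_cst.
- by rewrite -[X in _ --> X]addr0; apply: cvgD; [exact: cvg_cst|exact: cvg_inv_rejected].
Qed.

Let x : R := 1 - (expR 1)^-1.

(** With m = n + 1 - T, the drop at j + 1 is the drop at j times (m - j) / (n - j) times j / (j +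
    1), and (m - j) / (n - j) tends to 1 - 1 / e. *)
Lemma cvg_wdrop k : wdrop R n (n.+1 - rejected n) k.+1 @[n --> \oo] --> k.+1%:R^-1 * x ^+ k.+1.
Proof.
have invn := cvg_invn.
have Tn : (rejected n)%:R / n%:R @[n --> \oo] --> (expR 1 : R)^-1.
  apply: (@cvg_eventually_eq (fun n => (rejected n)%:R / n.+1%:R * (1 + n%:R^-1)) _ _ 1).
    move=> n n0; have n1 : (n%:R : R) != 0 by rewrite pnatr_eq0 -lt0n.
    by rewrite -natr1; field; rewrite n1 natr1 pnatr_eq0.
  rewrite -[X in _ --> X]mulr1; apply: cvgM; first exact: cvg_rejected.
  by rewrite -[X in _ --> X]addr0; apply: cvgD => //; exact: cvg_cst.
have ratio j : (1 - (rejected n)%:R / n%:R + n%:R^-1 - j%:R * n%:R^-1) / (1 - j%:R * n%:R^-1)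
    @[n --> \oo] --> x.
  have jn : j%:R * n%:R^-1 @[n --> \oo] --> (0 : R).
    by rewrite -[X in _ --> X](mulr0 j%:R); apply: cvgM => //; exact: cvg_cst.
  rewrite -[X in _ --> X]divr1; apply: cvgM.
    rewrite -[X in _ --> X]subr0 -[X in _ --> X - _]addr0.
    by apply: cvgB => //; apply: cvgD => //; apply: cvgB => //; exact: cvg_cst.
  apply: cvgV; first exact: oner_neq0.
  by rewrite -[X in _ --> X]subr0; apply: cvgB => //; exact: cvg_cst.
elim: k => [|k IH].
  rewrite invr1 mul1r expr1.
  apply: (@cvg_eventually_eq _ _ _ 6) (ratio 0%N) => n n6.
  have [u [Tu u0 nu un]] := threshold_range (n6 : (7 <= n.+1)%N).
  have n0 : (n%:R : R) != 0 by rewrite pnatr_eq0; lia.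
  apply: (mulIf n0); rewrite wdrop1; last by lia.
  rewrite natrB; last by rewrite /rejected Tu; lia.
  by rewrite -natr1; field.
have -> : k.+2%:R^-1 * x ^+ k.+2 = k.+1%:R^-1 * x ^+ k.+1 * x * (k.+1%:R / k.+2%:R).
  by have k0 := ler0n R k; rewrite [in LHS]exprS; field; rewrite !gt_eqF //; lra.
have L : wdrop R n (n.+1 - rejected n) k.+1
      * ((1 - (rejected n)%:R / n%:R + n%:R^-1 - k.+1%:R * n%:R^-1) / (1 - k.+1%:R * n%:R^-1))
      * (k.+1%:R / k.+2%:R) @[n --> \oo]
    --> k.+1%:R^-1 * x ^+ k.+1 * x * (k.+1%:R / k.+2%:R).
  by apply: cvgM; [apply: cvgM; [exact: IH|exact: ratio]|exact: cvg_cst].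
apply: (@cvg_eventually_eq _ _ _ (k.+1 * 3 + 6)%N) L => n nk.
have n6 : (6 <= n)%N by lia.
have [u [Tu u0 nu un]] := threshold_range (n6 : (7 <= n.+1)%N).
have n0 : (n%:R : R) != 0 by rewrite pnatr_eq0; lia.
have nk0 : (n%:R - k.+1%:R : R) != 0 by rewrite subr_eq0 eqr_nat; lia.
have mk : (k.+1 <= n.+1 - rejected n)%N by rewrite /rejected Tu; lia.
have := @wdropS R n (n.+1 - rejected n - k.+1) k.+1 isT; rewrite subnK //.
move=> /(_ ltac:(lia)); rewrite !natrB //; [|by rewrite /rejected Tu; lia|lia].
move=> e; have k20 : (k.+2%:R : R) != 0 by rewrite pnatr_eq0.
have d : (k.+2%:R * (n%:R - k.+1%:R) : R) != 0 by rewrite mulf_neq0.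
apply: (mulIf d); rewrite e -[n.+1%:R]natr1.
by field; rewrite -(natrD _ 2 k) nat1r n0 nk0 pnatr_eq0.
Qed.

(** Partial sums of the series of -ln (1 - x), whose value at x = 1 - 1 / e is 1. *)
Definition log_partial k : R := \sum_(1 <= s < k.+1) s%:R^-1 * x ^+ s.

Lemma cvg_weight k : weight R n (rejected n) k @[n --> \oo] --> 1 - log_partial k.
Proof.
elim: k => [|k IH].
  by rewrite /log_partial big_geq // subr0; exact: cvg_weight0.
rewrite /log_partial big_nat_recr //= opprD addrA.
have L : weight R n (rejected n) k - wdrop R n (n.+1 - rejected n) k.+1 @[n --> \oo]
    --> 1 - \sum_(1 <= s < k.+1) s%:R^-1 * x ^+ s - k.+1%:R^-1 * x ^+ k.+1.
  by apply: cvgB; [exact: IH|exact: cvg_wdrop].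
apply: (@cvg_eventually_eq _ _ _ (k + 6)%N) L => n nk.
have n6 : (6 <= n)%N by lia.
have [u [Tu u0 nu un]] := threshold_range (n6 : (7 <= n.+1)%N).
rewrite /= (@weightS _ _ _ k) /rejected ?Tu; [by rewrite addrK|lia|lia].
Qed.

(* [C(n-k,j) / C(n,j)] is multiplied by [(n-k-j)/(n-k) <= (n-T)/n <= 2/3] when
   [k] increases. *)
Lemma weight_geometric n k : (6 <= n)%N -> (k <= n)%N ->
  weight R n (rejected n) k <= (2 / 3) ^+ k * weight R n (rejected n) 0.
Proof.
move=> n6; have [u [Tu u0 nu un]] := threshold_range (n6 : (7 <= n.+1)%N).
elim: k => [|k IH] kn; first by rewrite expr0 mul1r.
rewrite exprS -mulrA; apply: le_trans (ler_wpM2l _ (IH (ltnW kn))); last by rewrite divr_ge0.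
rewrite /rejected Tu mulr_sumr; apply: ler_sum_nat => j /andP[Tj jn].
rewrite mulrA ler_wpM2r ?invr_ge0 ?mulr_ge0 // mulrAC ler_pdivlMr //.
rewrite -!natrM ler_nat.
have e := mul_bin_down (n - k) j.
have nk : (0 < n - k)%N by lia.
have {}e : ((n - k) * 'C(n - k.+1, j) = (n - k - j) * 'C(n - k, j))%N.
  by rewrite -e; congr (_ * 'C(_, _))%N; lia.
rewrite -(leq_pmul2l nk) mulnA e mulnAC [leqRHS]mulnA leq_mul2r.
by apply/orP; right; lia.
Qed.

(** Both bounds pass to the limit from the weights, the constant 2 bounding the weight at 0. They
    make the series sum to 1 without the power series of the logarithm. *)
Lemma log_partial_bounds k : 0 <= 1 - log_partial k <= 2 * (2 / 3) ^+ k.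
Proof.
have near_le (P : nat -> Prop) N : (forall n, (N <= n)%N -> P n) -> \forall n \near \oo, P n.
  by move=> H; near=> n; apply: H; near: n; exact: nbhs_infty_ge.
apply/andP; split.
  have W : weight R n (rejected n) k @[n --> \oo] --> 1 - log_partial k by exact: cvg_weight.
  apply: (cvgr_to_ge W); apply: (near_le _ 0%N) => n _; exact: weight_ge0.
have W : weight R n (rejected n) k @[n --> \oo] --> 1 - log_partial k by exact: cvg_weight.
apply: (cvgr_to_le W); apply: (near_le _ (k + 6)%N) => n nk.
have n6 : (6 <= n)%N by lia.
apply: le_trans (weight_geometric n6 (leq_trans (leq_addr _ _) nk)) _.
rewrite mulrC ler_wpM2r ?exprn_ge0 ?divr_ge0 //.
have [u [Tu u0 nu un]] := threshold_range (n6 : (7 <= n.+1)%N).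
have /andP[_ h] := weight0_bounds n6; apply: le_trans h _.
rewrite -[2]/(1 + 1) lerD2l invf_le1 /rejected ?Tu ?ltr0n // ler1n //.
Unshelve. all: by end_near. Qed.

Lemma a_tailE l : a_tail R l.+1 = 1 - log_partial l.
Proof.
apply: cvg_lim => //.
have part : log_partial k @[k --> \oo] --> (1 : R).
  apply: (@squeeze_eventually (fun k => 1 - 2 * (2 / 3) ^+ k) _ (fun=> 1) _ 0).
  - by move=> k _; have := log_partial_bounds k; lra.
  - rewrite -[X in _ --> X]subr0; apply: cvgB; first exact: cvg_cst.
    rewrite -[X in _ --> X](mulr0 2); apply: cvgM; first exact: cvg_cst.
    by apply: cvg_expr; rewrite ger0_norm; lra.
  - exact: cvg_cst.
rewrite -(cvg_shiftS (fun k => \sum_(l.+1 <= s < k) (s%:R^-1 * (1 - (expR 1)^-1) ^+ s))).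
have L : log_partial k - log_partial l @[k --> \oo] --> 1 - log_partial l.
  by apply: cvgB; [exact: part|exact: cvg_cst].
apply: (@cvg_eventually_eq _ _ _ l) L => k lk.
by rewrite /= /log_partial (big_cat_nat _ (n := l.+1)) //= addrAC subrr add0r.
Qed.

(** The tail from [l + 2] is nonnegative and the term at [l + 1] is positive. *)
Lemma a_tail_gt0 l : 0 < a_tail R l.+1.
Proof.
rewrite a_tailE; have /andP[+ _] := log_partial_bounds l.+1.
rewrite {1}/log_partial big_nat_recr //= -/(log_partial l).
have : 0 < l.+1%:R^-1 * x ^+ l.+1.
  rewrite mulr_gt0 ?invr_gt0 ?ltr0n // exprn_gt0 // subr_gt0 invf_lt1 ?expR_gt0 //.
  by rewrite expR_gt1.
move: (_ * x ^+ l.+1) => y; lra.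
Qed.

Lemma cvg_mix_weight (p : R) k : 0 < p ->
  mix_weight p n k @[n --> \oo] --> p * (expR 1)^-1 * (1 - log_partial k).
Proof.
move=> p0; have invn := cvg_invn.
have W : weight R n (rejected n) k @[n --> \oo] --> 1 - log_partial k by exact: cvg_weight.
have c (r : R) : r @[_ --> \oo] --> r by exact: cvg_cst.
have pT : (1 - p) / p * (rejected n)%:R^-1 @[n --> \oo] --> (0 : R).
  by rewrite -[X in _ --> X](mulr0 ((1 - p) / p)); apply: cvgM; [exact: c|exact: cvg_inv_rejected].
have kn : (k == 0%N)%:R * n%:R^-1 @[n --> \oo] --> (0 : R).
  by rewrite -[X in _ --> X](mulr0 (k == 0%N)%:R); apply: cvgM; [exact: c|].
have L : p * ((rejected n)%:R / n.+1%:R) * (n%:R^-1 + (1 - p) / p * (rejected n)%:R^-1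
      + weight R n (rejected n) k - (k == 0%N)%:R * n%:R^-1) @[n --> \oo]
    --> p * (expR 1)^-1 * (0 + 0 + (1 - log_partial k) - 0).
  apply: cvgM; first by apply: cvgM; [exact: c|exact: cvg_rejected].
  by apply: cvgB => //; apply: cvgD => //; exact: cvgD.
rewrite !add0r subr0 in L.
apply: (@cvg_eventually_eq _ _ _ 0) L => n _.
by rewrite /= /mix_weight /lweight -/(rejected n) invfM !mulrA.
Qed.
End Asymptotics.

Theorem theorem4 (R : realType) (l : nat) (p delta : R)
  (hl : (1 <= l)%N) (hp : 0 <= p <= 1) (hp0 : 0 < p)
  (hdelta : 0 <= delta <= 1) :
  (forall (n : nat) (sigma : 'S_n.+1),
     (7 <= n.+1)%N -> (l < n.+1)%N ->
     let M := p_mix hp (secretary n) (blind n) in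
     let q1 := sel_prob M sigma 1 in
     let ql1 := sel_prob M sigma l.+1 in
     let bound := if delta < q1 - ql1 then ln ((q1 - delta) / ql1) else 0 in
     (forall eps : R, bound <= eps -> diff_private l eps delta M)
     /\
     (* Tightness.  Where bound = 0 it is the least privacy parameter, as these
        are nonnegative; where bound > 0 every smaller real fails. *)
     (forall eps : R, (0 <= eps) \/ (delta < q1 - ql1) ->
        eps < bound -> ~ diff_private l eps delta M))
  /\
  (forall sigma : forall n : nat, 'S_n.+1,
     0 < p - delta * expR 1 ->
     p - delta * expR 1 != a_tail R l.+1 * p ->
     asymp_equiv
       (fun n => let M := p_mix hp (secretary n) (blind n) in
          ln ((sel_prob M (sigma n) 1 - delta) / sel_prob M (sigma n) l.+1))
       (fun=> ln ((p - delta * expR 1) / (a_tail R l.+1 * p)))).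
Proof.
split=> [n sigma n7 lN M q1 ql1 bound|sigma a0 ane].
  have p01 : 0 < p <= 1 by have /andP[_ ->] := hp; rewrite hp0.
  have d0 : 0 <= delta by case/andP: hdelta.
  have [u [Tu u0 nu un]] := threshold_range n7.
  have Tn : (0 < (threshold n.+1).-1 <= n)%N by rewrite Tu; lia.
  have q1E : q1 = mix_weight p n 0 by apply: sel_prob_mix.
  have qlE : ql1 = mix_weight p n l by apply: sel_prob_mix.
  have ql0 : 0 < ql1 by rewrite qlE mix_weight_gt0.
  (* When there is a gap, the bound on [eps] is equivalent to the inequality for ranks 0 and [l],
     which settles both sufficiency and tightness. *)
  have ln_gap : delta < q1 - ql1 -> forall eps, (ln ((q1 - delta) / ql1) <= eps)
      = (q1 <= expR eps * ql1 + delta).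
    move=> gap eps; have r0 : 0 < (q1 - delta) / ql1 by rewrite divr_gt0 //; lra.
    by rewrite -ler_expR lnK ?posrE // ler_pdivrMr // lerBlDr.
  split=> eps.
    rewrite /bound; case: ifPn => [gap|]; last first.
      rewrite -leNgt => gap eps0; apply: diff_private_mix => //.
        by rewrite -expR0 ler_expR.
      rewrite -q1E -qlE; have := ler_wpM2r (ltW ql0) (_ : 1 <= expR eps).
      by rewrite -expR0 ler_expR expR0 mul1r => /(_ eps0); lra.
    rewrite ln_gap // => he; apply: diff_private_mix => //; last by rewrite -q1E -qlE.
    by rewrite -(ler_pM2r ql0) mul1r; lra.
  (* Without a gap the bound is 0, and no nonnegative [eps] lies below it. *)
  rewrite /bound; case: ifPn => [gap _|gap [eps0|//] lt0 _]; last first.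
    by have := le_lt_trans eps0 lt0; rewrite ltxx.
  rewrite ltNge ln_gap // => /negP ne priv; apply: ne.
  by rewrite q1E qlE; exact: (diff_private_mix_only_if hl hp0 d0 n7 lN sigma priv).
have e0 : 0 < expR (1 : R) := expR_gt0 1.
have at0 := a_tail_gt0 R l.
set r := (p - delta * expR 1) / (a_tail R l.+1 * p).
have r0 : 0 < r by rewrite divr_gt0 // mulr_gt0.
(* The quotient of logarithms tends to 1 only if the constant [ln r] is nonzero; [ane] excludes r =
   1. *)
have lnr : ln r != 0.
  rewrite ln_eq0 //; apply: contra ane => /eqP r1.
  have nz : a_tail R l.+1 * p != 0 by rewrite gt_eqF // mulr_gt0.
  by apply/eqP; rewrite -[LHS](divfK nz) -/r r1 mul1r.
pose w k n := mix_weight p n k.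
have c1 : w 0%N n @[n --> \oo] --> p * (expR 1)^-1.
  have := @cvg_mix_weight R p 0 hp0.
  by rewrite /log_partial big_geq // subr0 mulr1.
have cl : w l n @[n --> \oo] --> p * (expR 1)^-1 * a_tail R l.+1.
  by rewrite a_tailE; exact: cvg_mix_weight.
have L : ln ((w 0%N n - delta) / w l n) / ln r @[n --> \oo] --> ln r / ln r.
  apply: cvgM; last exact: cvg_cst.
  have rE : r = (p * (expR 1)^-1 - delta) / (p * (expR 1)^-1 * a_tail R l.+1).
    by rewrite /r; field; rewrite !gt_eqF.
  have lr : (w 0%N n - delta) / w l n @[n --> \oo] --> r.
    rewrite rE; apply: cvgM; first by apply: cvgB => //; exact: cvg_cst.
    by apply: cvgV => //; rewrite gt_eqF // !mulr_gt0 ?invr_gt0.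
  exact: (cvg_comp _ _ lr (continuous_ln r0)).
rewrite divff // in L.
rewrite /asymp_equiv; apply: (@cvg_eventually_eq _ _ _ _ (l + 6)%N) L => n nl.
have [u [Tu u0 nu un]] := threshold_range (leq_trans (leq_addl l 6) nl : (7 <= n.+1)%N).
have Tn : (0 < (threshold n.+1).-1 <= n)%N by rewrite Tu; lia.
by rewrite !sel_prob_mix // (leq_trans (leq_addr 6 l)).
Qed.
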